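(* Let $\mathscr{C}=\{(x,y)\in\mathbb{C}^2 : y(1+2x^2y)=0\}$. Then the fundamental group of the regular locus $\mathbb{C}^2\setminus\mathscr{C}$ of the complexified planar Kepler problem is $$\pi_1\left(\mathbb{C}^2\setminus\mathscr{C}\right)\cong \mathbf{F}_2\rtimes\mathbb{Z},$$ where the generator of $\mathbb{Z}$ acts on $\mathbf{F}_2$ by interchanging the two generators of $\mathbf{F}_2$.
   Context: $\mathbf{F}_2$ denotes the free group on two generators. The semidirect product is formed with respect to the homomorphism $\mathbb{Z}\to\mathrm{Aut}(\mathbf{F}_2)$ sending the generator $1\in\mathbb{Z}$ to the automorphism of $\mathbf{F}_2=\langle a,b\rangle$ that exchanges $a$ and $b$. The space $\mathbb{C}^2\setminus\mathscr{C}$ carries the usual (Euclidean) topology. Terminology: $\mathscr{C}$ is the discriminant set of the integral map of the complexified planar Kepler problem, where $x$ is the value of the angular momentum and $y$ is the value of the energy. The regular locus of this system is the complement $\mathbb{C}^2\setminus\mathscr{C}$. *)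

(* Defs.v *)
From HB Require Import structures.
From mathcomp Require Import all_boot all_order all_algebra.
From mathcomp Require Import all_classical all_reals all_analysis.
From mathcomp Require Import homotopy complex generic_quotient zify lra.

Set Implicit Arguments.
Unset Strict Implicit.
Unset Printing Implicit Defensive.

Import Order.TTheory GRing.Theory Num.Theory.
Import numFieldNormedType.Exports.

Local Open Scope group_scope.

Section FreeGroup.
Variable X : choiceType.

(* The letter (x, false) is the generator x and (x, true) its inverse. *)
Definition letter_inv (l : X * bool) : X * bool := (l.1, ~~ l.2).

Definition reduced (w : seq (X * bool)) : bool :=
  sorted (fun l m => m != letter_inv l) w.

Definition freeGroup := {w : seq (X * bool) | reduced w}.

HB.instance Definition _ := [isSub for (@sval _ _ : freeGroup -> seq (X * bool))].
HB.instance Definition _ := [Choice of freeGroup by <:].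

Lemma letter_invK : involutive letter_inv.
Proof. by case=> x b; rewrite /letter_inv /= negbK. Qed.

Definition push (l : X * bool) (w : seq (X * bool)) : seq (X * bool) :=
  if w is m :: w' then if m == letter_inv l then w' else l :: w else [:: l].

Lemma push_reduced l w : reduced w -> reduced (push l w).
Proof.
case: w => [|m w] //= red_mw.
by case: ifPn => [_|neq_ml]; [exact: path_sorted red_mw | rewrite /= neq_ml].
Qed.

Lemma pushK l w : reduced w -> push (letter_inv l) (push l w) = w.
Proof.
case: w => [|m w] /=; first by rewrite letter_invK eqxx.
case: eqVneq => [-> | _] /=; last by rewrite letter_invK eqxx.
by case: w => [|m' w] //= /andP[/negPf ->].
Qed.

Lemma push_reduced_cons l w : reduced (l :: w) -> push l w = l :: w.
Proof. by case: w => //= m w /andP[/negPf->]. Qed.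

Definition word_mul (v w : seq (X * bool)) := foldr push w v.
Definition word_inv (w : seq (X * bool)) := rev (map letter_inv w).

Lemma word_mul_reduced v w : reduced w -> reduced (word_mul v w).
Proof. by move=> red_w; elim: v => //= l v; exact: push_reduced. Qed.

Lemma word_inv_reduced w : reduced w -> reduced (word_inv w).
Proof.
rewrite /reduced /word_inv rev_sorted sorted_map; apply: sub_sorted => l m /=.
by apply: contraNneq => ->; rewrite letter_invK.
Qed.

Lemma push_word_mul l v w :
  reduced w -> word_mul (push l v) w = push l (word_mul v w).
Proof.
move=> red_w; case: v => [|m v] //=; case: eqP => [->|] //=.
by rewrite -{1}[l]letter_invK pushK // word_mul_reduced.
Qed.

Lemma word_mulA u v w :
  reduced w -> word_mul u (word_mul v w) = word_mul (word_mul u v) w.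
Proof.
by move=> red_w; elim: u => //= l u ->; rewrite push_word_mul.
Qed.

Lemma word_mul1 w : reduced w -> word_mul w [::] = w.
Proof.
elim: w => //= l w IHw red_lw; rewrite (IHw (path_sorted red_lw)).
exact: push_reduced_cons.
Qed.

Lemma word_mulV w u : reduced u -> word_mul (word_inv w) (word_mul w u) = u.
Proof.
move=> red_u; elim: w => //= l w IHw.
rewrite /word_inv /= rev_cons /word_mul -cats1 foldr_cat /=.
by rewrite pushK ?word_mul_reduced.
Qed.

Definition fg_one : freeGroup := exist _ [::] isT.
Definition fg_mul (u v : freeGroup) : freeGroup :=
  exist _ (word_mul (val u) (val v)) (word_mul_reduced (val u) (valP v)).
Definition fg_inv (u : freeGroup) : freeGroup :=
  exist _ (word_inv (val u)) (word_inv_reduced (valP u)).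

Fact fg_mulA : associative fg_mul.
Proof. by move=> u v w; apply: val_inj; exact: word_mulA (valP w). Qed.
Fact fg_mul1g : left_id fg_one fg_mul.
Proof. by move=> u; apply: val_inj. Qed.
Fact fg_mulg1 : right_id fg_one fg_mul.
Proof. by move=> u; apply: val_inj; exact: word_mul1 (valP u). Qed.
Fact fg_mulVg : left_inverse fg_one fg_inv fg_mul.
Proof.
move=> u; apply: val_inj; rewrite /= -{2}[val u](word_mul1 (valP u)).
exact: word_mulV.
Qed.
Fact fg_mulgV : right_inverse fg_one fg_inv fg_mul.
Proof.
move=> u; rewrite -[fg_mul u _]fg_mul1g -{1}(fg_mulVg (fg_inv u)) -fg_mulA.
by rewrite [fg_mul (fg_inv u) _]fg_mulA fg_mulVg fg_mul1g fg_mulVg.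
Qed.

HB.instance Definition _ :=
  isGroup.Build freeGroup fg_mulA fg_mul1g fg_mulg1 fg_mulVg fg_mulgV.

Definition fg_gen (x : X) : freeGroup := exist _ [:: (x, false)] isT.
End FreeGroup.

Section FreeGroupMap.
Variables (X : choiceType) (G : groupType).

Definition letter_eval (f : X -> G) (l : X * bool) : G :=
  if l.2 then (f l.1)^-1 else f l.1.

(* The homomorphism extending f, by the universal property of F(X). *)
Definition fg_lift (f : X -> G) (w : freeGroup X) : G :=
  foldr (fun l g => letter_eval f l * g) 1 (val w).

Lemma fg_lift_gen f x : fg_lift f (fg_gen x) = f x.
Proof. exact: mulg1. Qed.

Lemma fg_liftM f : {morph fg_lift f : u v / u * v}.
Proof.
move=> u v; rewrite /fg_lift /= /word_mul; elim: (val u) => [|l w] /=.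
  by rewrite mul1g.
move=> IHw; rewrite -mulgA -IHw; case: (foldr _ _ w) => [|m w'] //=.
case: eqP => // -> /=; rewrite mulgA.
by case: l => x [] /=; rewrite /letter_eval /= ?mulgV ?mulVg mul1g.
Qed.

HB.instance Definition _ f :=
  isMultiplicative.Build (freeGroup X) G (fg_lift f) (@fg_liftM f).

Lemma fg_lift_unique (f : {multiplicative freeGroup X -> G}) :
  f =1 fg_lift (f \o @fg_gen X).
Proof.
have f1 : f 1 = 1 by apply: (mulgI (f 1)); rewrite -gmulfM !mulg1.
case=> w; elim: w => [|l w IHw] red_lw.
  by rewrite -[RHS]f1; congr (f _); apply: val_inj.
pose r : freeGroup X := exist _ w (path_sorted red_lw).
pose x := fg_gen l.1; pose y := if l.2 then x^-1 else x.
have -> : exist _ (l :: w) red_lw = y * r :> freeGroup X.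
  apply: val_inj; rewrite -[LHS]push_reduced_cons // /y /x.
  by case: (l) => z [].
rewrite gmulfM fg_liftM IHw /y /x; congr (_ * _).
case: l.2; last by rewrite fg_lift_gen.
apply: (mulgI (f x)); rewrite -gmulfM mulgV f1.
rewrite -[f x](fg_lift_gen (f \o @fg_gen X)) -fg_liftM mulgV.
by [].
Qed.

End FreeGroupMap.

Section Aut.
Variable G : groupType.

Record aut := Aut {
  aut_fun :> G -> G;
  aut_inv : G -> G;
  _ : {morph aut_fun : x y / x * y};
  _ : cancel aut_fun aut_inv;
  _ : cancel aut_inv aut_fun }.

HB.instance Definition _ := gen_eqMixin aut.
HB.instance Definition _ := gen_choiceMixin aut.

Lemma autM (f : aut) : {morph f : x y / x * y}. Proof. by case: f. Qed.
Lemma autK (f : aut) : cancel f (aut_inv f). Proof. by case: f. Qed.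
Lemma autVK (f : aut) : cancel (aut_inv f) f. Proof. by case: f. Qed.

Lemma aut_eqP (f g : aut) : f =1 g -> f = g.
Proof.
move=> eqfg; have /funext eqfg' : aut_inv f =1 aut_inv g.
  by move=> x; rewrite -[x in LHS](autVK g) -eqfg autK.
move/funext: eqfg; case: f g eqfg' => f f' ? ? ? [g g' ? ? ?] /= ef' ef.
by subst g g'; congr Aut; apply: Prop_irrelevance.
Qed.

Lemma aut_invM (f : aut) : {morph aut_inv f : x y / x * y}.
Proof. by move=> x y; rewrite -[LHS](autK f) -{1}(autVK f x) -{1}(autVK f y) -autM !autK. Qed.

Definition aut_one : aut :=
  @Aut id id (fun _ _ => erefl) (fun _ => erefl) (fun _ => erefl).

Definition aut_comp (f g : aut) : aut :=
  @Aut (f \o g) (aut_inv g \o aut_inv f)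
    (fun x y => etrans (congr1 f (autM g x y)) (autM f _ _))
    (can_comp (autK f) (autK g)) (can_comp (autVK g) (autVK f)).

Definition aut_opp (f : aut) : aut :=
  @Aut (aut_inv f) f (@aut_invM f) (autVK f) (autK f).

Fact aut_compA : associative aut_comp. Proof. by move=> f g h; apply: aut_eqP. Qed.
Fact aut_comp1f : left_id aut_one aut_comp. Proof. by move=> f; apply: aut_eqP. Qed.
Fact aut_compf1 : right_id aut_one aut_comp. Proof. by move=> f; apply: aut_eqP. Qed.
Fact aut_compVf : left_inverse aut_one aut_opp aut_comp.
Proof. by move=> f; apply: aut_eqP => x; exact: autK. Qed.
Fact aut_compfV : right_inverse aut_one aut_opp aut_comp.
Proof. by move=> f; apply: aut_eqP => x; exact: autVK. Qed.

HB.instance Definition _ :=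
  isGroup.Build aut aut_compA aut_comp1f aut_compf1 aut_compVf aut_compfV.

Lemma aut1 (f : aut) : f 1 = 1.
Proof. by apply: (mulgI (f 1)); rewrite -autM !mulg1. Qed.
End Aut.

Section IntPower.
Variable G : groupType.

(* The homomorphism from the infinite cyclic group to G sending 1 to g. *)
Definition zpow (g : G) (n : Algebra.to_multiplicative int) : G :=
  match n with Posz m => g ^+ m | Negz m => g ^- m.+1 end.

Lemma zpow1 g : zpow g 1%Z = g. Proof. exact: expg1. Qed.

Lemma zpowS (g : G) (n : int) : zpow g (n + 1)%R = zpow g n * g.
Proof.
case: n => [n|[|n]].
- have -> : (Posz n + 1)%R = Posz n.+1 by lia.
  exact: expgSr.
- by rewrite /= expg1 mulVg.
have -> : (Negz n.+1 + 1)%R = Negz n by lia.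
by rewrite /= [in RHS]expgS invgM mulgVK.
Qed.

Lemma zpowM (g : G) : {morph zpow g : m n / m * n}.
Proof.
have zpowB (n : int) : zpow g (n - 1)%R = zpow g n * g^-1.
  by rewrite -[in RHS](GRing.subrK 1%R n) zpowS mulgK.
move=> m; elim/int_ind=> [|n IHn|n IHn].
- by rewrite [m * _]GRing.addr0 mulg1.
- have -> : (n.+1%:Z)%R = (n%:Z + 1)%R by lia.
  by rewrite [m * _]GRing.addrA !zpowS IHn mulgA.
- have -> : (- n.+1%:Z)%R = (- n%:Z - 1)%R by lia.
  by rewrite [m * _]GRing.addrA !zpowB IHn mulgA.
Qed.

HB.instance Definition _ (g : G) :=
  isMultiplicative.Build (Algebra.to_multiplicative int) G (zpow g) (@zpowM g).
End IntPower.

Section SemidirectProduct.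
Variables N H : groupType.

Definition semidirect of {multiplicative H -> aut N} : Type := (N * H)%type.

Variable phi : {multiplicative H -> aut N}.

HB.instance Definition _ := Choice.on (semidirect phi).

Definition sd_one : semidirect phi := (1, 1).
Definition sd_mul (u v : semidirect phi) : semidirect phi :=
  (u.1 * phi u.2 v.1, u.2 * v.2).
Definition sd_inv (u : semidirect phi) : semidirect phi :=
  (phi u.2^-1 u.1^-1, u.2^-1).

Lemma sd_act1 : phi 1 = 1.
Proof. by apply: (mulgI (phi 1)); rewrite -gmulfM !mulg1. Qed.

Lemma sd_actM h k x : phi (h * k) x = phi h (phi k x).
Proof. by rewrite gmulfM. Qed.

Fact sd_mulA : associative sd_mul.
Proof.
by move=> u v w; rewrite /sd_mul /= autM sd_actM !mulgA.
Qed.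
Fact sd_mul1g : left_id sd_one sd_mul.
Proof. by case=> n h; rewrite /sd_mul /= sd_act1 !mul1g. Qed.
Fact sd_mulg1 : right_id sd_one sd_mul.
Proof. by case=> n h; rewrite /sd_mul /= aut1 !mulg1. Qed.
Fact sd_mulVg : left_inverse sd_one sd_inv sd_mul.
Proof. by case=> n h; rewrite /sd_mul /= -autM !mulVg aut1. Qed.
Fact sd_mulgV : right_inverse sd_one sd_inv sd_mul.
Proof.
by case=> n h; rewrite /sd_mul /= -sd_actM mulgV sd_act1 mulgV.
Qed.

HB.instance Definition _ :=
  isGroup.Build (semidirect phi) sd_mulA sd_mul1g sd_mulg1 sd_mulVg sd_mulgV.
End SemidirectProduct.
Arguments semidirect {N H} phi.

Definition F2 : groupType := freeGroup bool.

(* The endomorphism exchanging the generators [fg_gen false] and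
   [fg_gen true]. *)
Definition swap_fun : F2 -> F2 := fg_lift (fun c : bool => fg_gen (~~ c)).

Lemma swap_funK : involutive swap_fun.
Proof.
pose h : {multiplicative F2 -> F2} := @fg_lift bool F2 (fun c => fg_gen (~~ c)).
move=> w; transitivity ((h \o h) w) => //.
rewrite (fg_lift_unique (h \o h)) [RHS](fg_lift_unique idfun).
congr (fg_lift _ w); apply/funext => c /=.
by rewrite /h /= !fg_lift_gen negbK.
Qed.

Definition swap : aut F2 :=
  @Aut F2 swap_fun swap_fun (@fg_liftM bool F2 _) swap_funK swap_funK.

Lemma swap_gen c : swap (fg_gen c) = fg_gen (~~ c).
Proof. exact: fg_lift_gen. Qed.

Local Close Scope group_scope.
Local Open Scope complex_scope.
Local Open Scope classical_set_scope.
Local Open Scope ring_scope.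
Local Open Scope quotient_scope.

Section UnitInterval.
Variable R : realType.

Definition unitI : Type := set_type (`[0, 1]%classic : set R).

HB.instance Definition _ := Topological.on unitI.

Definition clampR (t : R) : R := Num.max 0 (Num.min t 1).

Lemma clampR_in t : clampR t \in (`[0, 1]%classic : set R).
Proof.
by rewrite mem_setE in_itv /= /clampR le_max lexx ge_max ler01 ge_min lexx orbT.
Qed.

(* The retraction of the line onto the unit interval: loops are reparametrized
   by real arithmetic followed by [clamp]. *)
Definition clamp (t : R) : unitI := exist _ (clampR t) (clampR_in t).

Lemma unitI_ge0 (t : unitI) : 0 <= val t.
Proof. by have /set_mem := valP t; rewrite /= in_itv /= => /andP[]. Qed.

Lemma unitI_le1 (t : unitI) : val t <= 1.
Proof. by have /set_mem := valP t; rewrite /= in_itv /= => /andP[]. Qed.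

Lemma val_clamp t : 0 <= t <= 1 -> val (clamp t) = t.
Proof.
by move=> /andP[t0 t1]; rewrite /= /clampR (min_idPl t1) (max_idPr t0).
Qed.

Lemma valK_clamp (t : unitI) : clamp (val t) = t.
Proof. by apply: val_inj; rewrite val_clamp // unitI_ge0 unitI_le1. Qed.

Lemma clamp_le0 t : t <= 0 -> clamp t = clamp 0.
Proof.
move=> t0; apply: val_inj; rewrite [RHS]val_clamp ?lexx ?ler01 //= /clampR.
apply/max_idPl; rewrite ge_min t0 //.
Qed.

Lemma clamp_ge1 t : 1 <= t -> clamp t = clamp 1.
Proof.
move=> t1; apply: val_inj; rewrite [RHS]val_clamp ?lexx ?ler01 //= /clampR.
by rewrite (min_idPr t1); apply/max_idPr.
Qed.

Lemma clamp01 : clamp 0 != clamp 1.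
Proof.
apply/eqP => /(congr1 val); rewrite !val_clamp ?lexx ?ler01 //.
by apply/eqP; rewrite eq_sym oner_eq0.
Qed.

HB.instance Definition _ := isBiPointed.Build unitI clamp01.

Lemma val_unitI_continuous : continuous (val : unitI -> R).
Proof. exact: initial_continuous. Qed.

Lemma clamp_continuous : continuous clamp.
Proof.
apply: continuous_comp_initial.
have -> : set_val \o clamp = cst 0 \max (idfun \min cst 1) by [].
apply: max_fun_continuous; first exact: cst_continuous.
apply: min_fun_continuous; last exact: cst_continuous.
by move=> t; exact: cvg_id.
Qed.
End UnitInterval.

Section Paste.
Context {R : realType} {S T : topologicalType}.

Lemma paste_continuous (k : S -> R) (F G : S -> T) :
  continuous k -> continuous F -> continuous G ->
  (forall s, k s = 0 -> F s = G s) ->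
  continuous (fun s => if k s <= 0 then F s else G s).
Proof.
move=> ck cF cG eqFG; set h := (X in continuous X).
have clA : closed [set s | k s <= 0].
  exact: (closed_comp (fun x _ => ck x) (@closed_le _ 0)).
have clB : closed [set s | 0 <= k s].
  exact: (closed_comp (fun x _ => ck x) (@closed_ge _ 0)).
apply/continuous_subspace_setT.
have -> : [set: S] = [set s | k s <= 0] `|` [set s | 0 <= k s].
  by apply/seteqP; split=> s //= _; apply/orP; exact: le_total.
apply: withinU_continuous => //.
- apply: (@subspace_eq_continuous _ _ _ F); last exact: continuous_subspaceT.
  by move=> s; rewrite inE /= /from_subspace /h /= => ->.
- apply: (@subspace_eq_continuous _ _ _ G); last exact: continuous_subspaceT.
  move=> s; rewrite inE /= /from_subspace /h /= => k0.
  by case: ifP => // k0'; rewrite eqFG //; apply/eqP; rewrite eq_le k0 k0'.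
Qed.
End Paste.

Section ContinuityAux.
Context {R : realType} {S : topologicalType}.

Lemma continuous_pair {U V : topologicalType} (a : S -> U) (b : S -> V) :
  continuous a -> continuous b -> continuous (fun s => (a s, b s)).
Proof. by move=> ca cb s; apply: cvg_pair; [exact: ca | exact: cb]. Qed.

Lemma continuous_compT {U V : topologicalType} (g : U -> V) (a : S -> U) :
  continuous g -> continuous a -> continuous (fun s => g (a s)).
Proof.
by move=> cg ca s; apply: continuous_comp; [exact: ca | exact: cg].
Qed.

Lemma continuousDR (a b : S -> R) :
  continuous a -> continuous b -> continuous (fun s => a s + b s).
Proof. by move=> ca cb s; apply: cvgD; [exact: ca | exact: cb]. Qed.

Lemma continuousBR (a b : S -> R) :
  continuous a -> continuous b -> continuous (fun s => a s - b s).
Proof. by move=> ca cb s; apply: cvgB; [exact: ca | exact: cb]. Qed.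

Lemma continuousMR (a b : S -> R) :
  continuous a -> continuous b -> continuous (fun s => a s * b s).
Proof. by move=> ca cb s; apply: cvgM; [exact: ca | exact: cb]. Qed.
End ContinuityAux.

Lemma continuous_fstT {U V : topologicalType} :
  continuous (fst : U * V -> U).
Proof. by move=> s; exact: cvg_fst. Qed.

Lemma continuous_sndT {U V : topologicalType} :
  continuous (snd : U * V -> V).
Proof. by move=> s; exact: cvg_snd. Qed.

Lemma continuous_idT {U : topologicalType} : continuous (fun u : U => u).
Proof. by move=> s; exact: cvg_id. Qed.

Ltac cont_step := first
  [ assumption
  | exact: cst_continuous | exact: continuous_idT
  | exact: continuous_fstT | exact: continuous_sndT
  | exact: clamp_continuous | exact: val_unitI_continuous
  | refine (continuous_pair _ _)
  | refine (continuousBR _ _) | refine (continuousDR _ _)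
  | refine (continuousMR _ _)
  | refine (continuous_compT (@clamp_continuous _) _)
  | refine (continuous_compT (@val_unitI_continuous _) _)
  | match goal with c : _ |- _ => refine (continuous_compT c _) end ].
Ltac cont := solve [repeat cont_step].

Section Loops.
Context {R : realType} {T : topologicalType} (x : T).
Local Notation I := (unitI R).
Local Notation loop := (@pathType I T x x).

Definition homotopic (f g : loop) : Prop :=
  exists H : I * I -> T, [/\ continuous H,
    forall t, H (t, zero) = f t,
    forall t, H (t, one) = g t,
    forall s, H (zero, s) = x &
    forall s, H (one, s) = x].

Definition loop_line (f : loop) (t : R) : T := f (clamp t).

Lemma loop_line_continuous f : continuous (loop_line f).
Proof. by apply: continuous_compT; [exact: cts_fun | exact: clamp_continuous]. Qed.

Lemma loop_line_le0 f t : t <= 0 -> loop_line f t = x.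
Proof. by move=> t0; rewrite /loop_line clamp_le0 //; exact: path_zero. Qed.

Lemma loop_line_ge1 f t : 1 <= t -> loop_line f t = x.
Proof. by move=> t1; rewrite /loop_line clamp_ge1 //; exact: path_one. Qed.

Lemma loop_lineE f (t : I) : loop_line f (val t) = f t.
Proof. by rewrite /loop_line valK_clamp. Qed.

Lemma val_zero : val (zero : I) = 0.
Proof. by rewrite val_clamp // lexx ler01. Qed.

Lemma val_one : val (one : I) = 1.
Proof. by rewrite val_clamp // lexx ler01. Qed.

Lemma homotopic_intro (f g : loop) (H : R * R -> T) :
  continuous H ->
  (forall t, 0 <= t <= 1 -> H (t, 0) = loop_line f t) ->
  (forall t, 0 <= t <= 1 -> H (t, 1) = loop_line g t) ->
  (forall s, 0 <= s <= 1 -> H (0, s) = x) ->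
  (forall s, 0 <= s <= 1 -> H (1, s) = x) ->
  homotopic f g.
Proof.
move=> cH H0 H1 H0s H1s; exists (fun p => H (val p.1, val p.2)).
have valI (t : I) : 0 <= val t <= 1 by rewrite unitI_ge0 unitI_le1.
split=> [|t|t|s|s]; rewrite ?[fst _]/= ?[snd _]/= ?val_zero ?val_one.
- by cont.
- by rewrite H0 ?loop_lineE.
- by rewrite H1 ?loop_lineE.
- exact: H0s.
- exact: H1s.
Qed.

Lemma homotopic_elim (f g : loop) :
  homotopic f g -> exists H : R * R -> T, [/\ continuous H,
  (forall t s, s <= 0 -> H (t, s) = loop_line f t),
  (forall t s, 1 <= s -> H (t, s) = loop_line g t),
  (forall t s, t <= 0 -> H (t, s) = x) &
  (forall t s, 1 <= t -> H (t, s) = x)].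
Proof.
move=> [H [cH H0 H1 H0s H1s]]; exists (fun p => H (clamp p.1, clamp p.2)).
split=> [|t s s0|t s s1|t s t0|t s t1] /=.
- by cont.
- by rewrite (clamp_le0 s0) H0.
- by rewrite (clamp_ge1 s1) H1.
- by rewrite (clamp_le0 t0) H0s.
- by rewrite (clamp_ge1 t1) H1s.
Qed.

Lemma homotopic_refl f : homotopic f f.
Proof.
apply: (@homotopic_intro _ _ (fun p => loop_line f p.1)) => //=.
- by refine (continuous_compT (@loop_line_continuous f) _); cont.
- by move=> s _; rewrite loop_line_le0.
- by move=> s _; rewrite loop_line_ge1.
Qed.

Lemma homotopic_sym f g : homotopic f g -> homotopic g f.
Proof.
move=> /homotopic_elim[H [cH H0 H1 H0s H1s]].
apply: (@homotopic_intro _ _ (fun p => H (p.1, 1 - p.2))) => /=.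
- by cont.
- by move=> t _; rewrite H1 ?subr0.
- by move=> t _; rewrite H0 ?subrr.
- by move=> s _; rewrite H0s.
- by move=> s _; rewrite H1s.
Qed.

Lemma homotopic_trans f g h :
  homotopic f g -> homotopic g h -> homotopic f h.
Proof.
move=> /homotopic_elim[H [cH H0 H1 H0s H1s]].
move=> /homotopic_elim[K [cK K0 K1 K0s K1s]].
apply: (@homotopic_intro _ _ (fun p => if 2 * p.2 - 1 <= 0
  then H (p.1, 2 * p.2) else K (p.1, 2 * p.2 - 1))) => /=.
- apply: (@paste_continuous R _ _ (fun p : R * R => 2 * p.2 - 1)).
  + by cont.
  + by cont.
  + by cont.
  + by move=> p p0; rewrite K0 ?H1 //; lra.
- by move=> t _; rewrite ifT ?H0 //; lra.
- by move=> t _; rewrite ifF ?K1 //; lra.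
- by move=> s _; case: ifP => _; rewrite ?H0s ?K0s.
- by move=> s _; case: ifP => _; rewrite ?H1s ?K1s.
Qed.

Lemma homotopic_reparam (f g h : loop) (phi psi : R -> R) :
  continuous phi -> continuous psi -> phi 0 = psi 0 -> phi 1 = psi 1 ->
  (forall t, 0 <= t <= 1 -> loop_line f t = loop_line h (phi t)) ->
  (forall t, 0 <= t <= 1 -> loop_line g t = loop_line h (psi t)) ->
  homotopic f g.
Proof.
move=> cphi cpsi e0 e1 fE gE.
have I0 : 0 <= (0 : R) <= 1 by rewrite lexx ler01.
have I1 : 0 <= (1 : R) <= 1 by rewrite lexx ler01.
apply: (@homotopic_intro _ _ (fun p =>
  loop_line h (phi p.1 + p.2 * (psi p.1 - phi p.1)))) => /=.
- refine (continuous_compT (@loop_line_continuous h) _).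
  by cont.
- by move=> t tI; rewrite mul0r addr0 fE.
- by move=> t tI; rewrite mul1r subrKC gE.
- by move=> s _; rewrite e0 subrr mulr0 addr0 -gE // loop_line_le0.
- by move=> s _; rewrite e1 subrr mulr0 addr0 -gE // loop_line_ge1.
Qed.

Section Concat.
Variables f g : loop.

Definition concat_fun (t : I) : T :=
  if 2 * val t - 1 <= 0 then f (clamp (2 * val t))
  else g (clamp (2 * val t - 1)).

Lemma concat_continuous : continuous concat_fun.
Proof.
have cv : continuous (fun t : I => 2 * val t - 1).
  by cont.
apply: (@paste_continuous R _ _ _ _ _ cv).
- refine (continuous_compT (@loop_line_continuous f) _).
  by cont.
- exact: (continuous_compT (@loop_line_continuous g)).
- move=> t t0; rewrite t0 -[f _]/(loop_line f _) -[g _]/(loop_line g _).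
  by rewrite loop_line_ge1 ?loop_line_le0 //; lra.
Qed.

Lemma concat_zero : concat_fun zero = x.
Proof.
rewrite /concat_fun val_zero -[f _]/(loop_line f _) ifT ?loop_line_le0 //; lra.
Qed.

Lemma concat_one : concat_fun one = x.
Proof.
rewrite /concat_fun val_one -[g _]/(loop_line g _) ifF ?loop_line_ge1 //; lra.
Qed.

Definition concat : loop := mk_path concat_continuous concat_zero concat_one.

Lemma concat_line t : loop_line concat t =
  if 2 * t - 1 <= 0 then loop_line f (2 * t) else loop_line g (2 * t - 1).
Proof.
case: (leP t 0) => t0.
  by rewrite ifT ?loop_line_le0 //; lra.
case: (leP 1 t) => t1.
  by rewrite ifF ?loop_line_ge1 //; lra.
transitivity (concat_fun (clamp t)) => //.
by rewrite /concat_fun val_clamp ?(ltW t0) ?(ltW t1).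
Qed.
End Concat.

Section Reverse.
Variable f : loop.

Definition reverse_fun (t : I) : T := f (clamp (1 - val t)).

Lemma reverse_continuous : continuous reverse_fun.
Proof.
refine (continuous_compT (@loop_line_continuous f) _).
by cont.
Qed.

Lemma reverse_zero : reverse_fun zero = x.
Proof. by rewrite /reverse_fun val_zero -/(loop_line f _) loop_line_ge1 ?subr0. Qed.

Lemma reverse_one : reverse_fun one = x.
Proof. by rewrite /reverse_fun val_one -/(loop_line f _) loop_line_le0 ?subrr. Qed.

Definition reverse : loop :=
  mk_path reverse_continuous reverse_zero reverse_one.

Lemma reverse_line t : loop_line reverse t = loop_line f (1 - t).
Proof.
case: (leP t 0) => t0.
  by rewrite loop_line_le0 ?loop_line_ge1 //; lra.
case: (leP 1 t) => t1.
  by rewrite loop_line_ge1 ?loop_line_le0 //; lra.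
transitivity (reverse_fun (clamp t)) => //.
by rewrite /reverse_fun val_clamp ?(ltW t0) ?(ltW t1).
Qed.
End Reverse.
End Loops.
Arguments loop_line : simpl never.
Arguments concat : simpl never.
Arguments reverse : simpl never.

Section FundamentalGroup.
Context {R : realType} {T : topologicalType} (x : T).
Local Notation I := (unitI R).
Local Notation loop := {path I from x to x in T}.
Implicit Types f g h : loop.

Lemma concat_homotopic f f' g g' :
  homotopic f f' -> homotopic g g' -> homotopic (concat f g) (concat f' g').
Proof.
move=> /homotopic_elim[H [cH H0 H1 H0s H1s]].
move=> /homotopic_elim[K [cK K0 K1 K0s K1s]].
apply: (@homotopic_intro _ _ _ _ _ (fun p => if 2 * p.1 - 1 <= 0
  then H (2 * p.1, p.2) else K (2 * p.1 - 1, p.2))) => /=.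
- apply: (@paste_continuous R _ _ (fun p : R * R => 2 * p.1 - 1)).
  + by cont.
  + by cont.
  + by cont.
  + by move=> p p0; rewrite K0s ?H1s //; lra.
- by move=> t _; rewrite concat_line H0 // K0.
- by move=> t _; rewrite concat_line H1 // K1.
- by move=> s _; rewrite ifT ?H0s //; lra.
- by move=> s _; rewrite ifF ?K1s //; lra.
Qed.

Lemma reverse_homotopic f g : homotopic f g -> homotopic (reverse f) (reverse g).
Proof.
move=> /homotopic_elim[H [cH H0 H1 H0s H1s]].
apply: (@homotopic_intro _ _ _ _ _ (fun p => H (1 - p.1, p.2))) => /=.
- by cont.
- by move=> t _; rewrite reverse_line H0.
- by move=> t _; rewrite reverse_line H1.
- by move=> s _; rewrite H1s ?subr0.
- by move=> s _; rewrite H0s ?subrr.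
Qed.

Definition const_loop : loop := [the loop of cst x].

Lemma const_line t : loop_line const_loop t = x. Proof. by []. Qed.

Lemma min_continuous2 (a b : R -> R) :
  continuous a -> continuous b -> continuous (fun t => Num.min (a t) (b t)).
Proof. exact: min_fun_continuous. Qed.

Lemma concatA_homotopic f g h :
  homotopic (concat f (concat g h)) (concat (concat f g) h).
Proof.
pose phi (t : R) := Num.min (2 * t) (Num.min (t + 4^-1) (2^-1 * t + 2^-1)).
apply: homotopic_sym; apply: (@homotopic_reparam _ _ _ _ _
  (concat f (concat g h)) phi id).
- by refine (min_continuous2 _ (min_continuous2 _ _)); cont.
- by cont.
- by rewrite /phi [Num.min (0 + _) _]min_l ?min_l /=; lra.
- by rewrite /phi [Num.min (1 + _) _]min_r ?min_r /=; lra.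
- move=> t /andP[t0 t1]; rewrite !concat_line /phi.
  case: (leP (2 * t - 1) 0) => t2.
    case: (leP (2 * (2 * t) - 1) 0) => t4.
      rewrite min_l; last by rewrite le_min; apply/andP; split; lra.
      by rewrite ifT //; lra.
    rewrite [Num.min (t + _) _]min_l; last by lra.
    rewrite min_r; last by lra.
    rewrite [in RHS]ifF; last by lra.
    rewrite ifT; last by lra.
    by congr loop_line; lra.
  rewrite [Num.min (t + _) _]min_r; last by lra.
  rewrite min_r; last by lra.
  rewrite ifF; last by lra.
  rewrite ifF; last by lra.
  by congr loop_line; lra.
- by [].
Qed.

Lemma concat1l_homotopic f : homotopic (concat const_loop f) f.
Proof.
pose phi (t : R) := - Num.min 0 (1 - 2 * t).
apply: (@homotopic_reparam _ _ _ _ _ f phi id).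
- refine (continuous_compT (@oppr_continuous R R) (min_continuous2 _ _)); cont.
- by cont.
- by rewrite /phi; case: leP; lra.
- by rewrite /phi; case: leP; lra.
- move=> t _; rewrite concat_line const_line /phi.
  case: ifP => t2.
    by rewrite min_l ?loop_line_le0 //; lra.
  by rewrite min_r; [congr loop_line; lra | lra].
- by [].
Qed.

Lemma concat1r_homotopic f : homotopic (concat f const_loop) f.
Proof.
pose phi (t : R) := Num.min 1 (2 * t).
apply: (@homotopic_reparam _ _ _ _ _ f phi id).
- refine (min_continuous2 _ _); cont.
- by cont.
- by rewrite /phi; case: leP; lra.
- by rewrite /phi; case: leP; lra.
- move=> t _; rewrite concat_line const_line /phi.
  case: ifP => t2.
    by rewrite min_r //; lra.
  by rewrite min_l ?loop_line_ge1 //; lra.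
- by [].
Qed.

Lemma concatVl_homotopic f : homotopic (concat (reverse f) f) const_loop.
Proof.
apply: (@homotopic_reparam _ _ _ _ _ f (fun t => 1 - Num.min (2 * t) (2 - 2 * t)) (cst 1)).
- have c := min_continuous2 (a := fun t : R => 2 * t) (b := fun t : R => 2 - 2 * t).
  refine (continuousBR _ (c _ _)); cont.
- by cont.
- by rewrite /=; case: leP; lra.
- by rewrite /=; case: leP; lra.
- move=> t _; rewrite concat_line reverse_line.
  by case: ifP => t2; case: leP => t2'; congr loop_line; lra.
- by move=> t _; rewrite [RHS]loop_line_ge1.
Qed.

Lemma concatVr_homotopic f : homotopic (concat f (reverse f)) const_loop.
Proof.
apply: (@homotopic_reparam _ _ _ _ _ f (fun t => Num.min (2 * t) (2 - 2 * t)) (cst 0)).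
- refine (min_continuous2 _ _); cont.
- by cont.
- by rewrite /=; case: leP; lra.
- by rewrite /=; case: leP; lra.
- move=> t _; rewrite concat_line reverse_line.
  by case: ifP => t2; case: leP => t2'; congr loop_line; lra.
- by move=> t _; rewrite [RHS]loop_line_le0.
Qed.

Definition homotopicb f g : bool := `[< homotopic f g >].

Fact homotopicb_refl : reflexive homotopicb.
Proof. by move=> f; apply/asboolP; exact: homotopic_refl. Qed.
Fact homotopicb_sym : symmetric homotopicb.
Proof. by move=> f g; apply/asboolP/asboolP; exact: homotopic_sym. Qed.
Fact homotopicb_trans : transitive homotopicb.
Proof.
by move=> g f h /asboolP fg /asboolP gh; apply/asboolP/(homotopic_trans fg gh).
Qed.

Canonical homotopic_equiv :=
  EquivRel homotopicb homotopicb_refl homotopicb_sym homotopicb_trans.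

Definition pi1 : Type := {eq_quot homotopic_equiv}.

HB.instance Definition _ := Choice.on pi1.

Definition pi1_class f : pi1 := \pi_({eq_quot homotopic_equiv}) f.

Lemma pi1_classP f g : pi1_class f = pi1_class g <-> homotopic f g.
Proof.
split=> [/eqmodP/asboolP // | fg].
by apply/eqmodP/asboolP.
Qed.

Lemma pi1_classK (u : pi1) : pi1_class (repr u) = u. Proof. exact: reprK. Qed.

Lemma repr_class f : homotopic (repr (pi1_class f)) f.
Proof. by apply/pi1_classP; rewrite pi1_classK. Qed.

Definition pi1_one : pi1 := pi1_class const_loop.
Definition pi1_mul (u v : pi1) : pi1 := pi1_class (concat (repr u) (repr v)).
Definition pi1_inv (u : pi1) : pi1 := pi1_class (reverse (repr u)).

Lemma pi1_class_concat f g :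
  pi1_class (concat f g) = pi1_mul (pi1_class f) (pi1_class g).
Proof.
apply/pi1_classP/homotopic_sym.
by apply: concat_homotopic; exact: repr_class.
Qed.

Lemma pi1_class_reverse f : pi1_class (reverse f) = pi1_inv (pi1_class f).
Proof. by apply/pi1_classP/homotopic_sym/reverse_homotopic/repr_class. Qed.

Lemma pi1_ind (P : pi1 -> Prop) : (forall f, P (pi1_class f)) -> forall u, P u.
Proof. by move=> Pf u; rewrite -[u]pi1_classK. Qed.

Fact pi1_mulA : associative pi1_mul.
Proof.
elim/pi1_ind => f; elim/pi1_ind => g; elim/pi1_ind => h.
by rewrite -!pi1_class_concat; apply/pi1_classP/concatA_homotopic.
Qed.
Fact pi1_mul1g : left_id pi1_one pi1_mul.
Proof.
elim/pi1_ind => f; rewrite -pi1_class_concat.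
exact/pi1_classP/concat1l_homotopic.
Qed.
Fact pi1_mulg1 : right_id pi1_one pi1_mul.
Proof.
elim/pi1_ind => f; rewrite -pi1_class_concat.
exact/pi1_classP/concat1r_homotopic.
Qed.
Fact pi1_mulVg : left_inverse pi1_one pi1_inv pi1_mul.
Proof.
elim/pi1_ind => f; rewrite -pi1_class_reverse -pi1_class_concat.
exact/pi1_classP/concatVl_homotopic.
Qed.
Fact pi1_mulgV : right_inverse pi1_one pi1_inv pi1_mul.
Proof.
elim/pi1_ind => f; rewrite -pi1_class_reverse -pi1_class_concat.
exact/pi1_classP/concatVr_homotopic.
Qed.

HB.instance Definition _ :=
  isGroup.Build pi1 pi1_mulA pi1_mul1g pi1_mulg1 pi1_mulVg pi1_mulgV.
End FundamentalGroup.
Arguments pi1 R {T} x.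

(* Each factor carries the topology of the complex modulus, and the plane the
   product topology. *)
Definition C2 (R : realType) : topologicalType := (R[i]^o * R[i]^o)%type.

Definition kepler_discriminant (R : realType) : set (C2 R) :=
  [set p | p.2 * (1 + 2 * p.1 ^+ 2 * p.2) = 0].

Definition kepler_regular_locus (R : realType) : topologicalType :=
  set_type (~` @kepler_discriminant R).

(* Main.v *)
(* On the locus write y = r e^(it) and x = v e^(-it/2) / (kappa sqrt r) with
   kappa^2 = -2; then 2 x^2 y = - v^2, so (v, t, r) ranges over
   (C \ {1, -1}) x R x R_{>0} and t -> t + 2 pi acts by v -> - v. A loop at
   (0, 1) therefore lifts to a path of arguments t, with an integral number of turns,
   and to a path v in the twice punctured plane, along which we transport
   an element h of the principal F_2-bundle obtained by cutting the plane along
   ]-oo, -1] and [1, +oo[. The end point (h, t / 2 pi) is invariant under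
   homotopy, and since v -> - v exchanges both cuts it is a homomorphism to the
   semidirect product; small explicit loops show that it is surjective.
   If it vanishes on a loop, then t and r can be contracted, and after
   collapsing a strip around the imaginary axis the loop v is a product of loops
   that each stay in one half-plane, hence are powers of a generator; so the
   loop is given by a word in F_2, which is trivial because it is the value h. *)

Require Import Defs.
From mathcomp Require Import all_boot all_order all_algebra.
From mathcomp Require Import all_classical all_reals all_analysis.
From HB Require Import structures.
From mathcomp Require Import homotopy complex zify ring lra.

Set Implicit Arguments.
Unset Strict Implicit.
Unset Printing Implicit Defensive.

Import Order.TTheory GRing.Theory Num.Theory.
Import numFieldNormedType.Exports ComplexField.Normc.

Local Open Scope complex_scope.
Local Open Scope classical_set_scope.
Local Open Scope ring_scope.

(** * Flat bundles over a square *)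

(** No covering space is constructed. A sheet is recorded by a function [h] into F_2, which may
    jump; what is controlled is its quotient by a chart potential, which is locally constant. Such
    functions exist over a square by gluing trivializations of a flat bundle, and one statement with
    the group as a parameter serves twice: the group (R, +) yields continuous arguments, F_2 yields
    sheets. Homotopy invariance is then uniqueness of lifts, applied along the edges of a square.
    The half angle in v is forced: 2 x^2 y becomes a square only through a root of y, which needs an
    argument t, and a full turn changes the sign of this root; hence the semidirect action. Cutting
    outward from 1 and -1 keeps v = 0, the position of the base point, off both cuts. Freeness needs
    no normal form for loops: the word [w] in the two circles has monodromy [(w, 1)], so evaluation
    of words has a left inverse. All this is done at (0, 1); explicit paths in the locus carry any
    other base point there. *)

Lemma locally_constant_connected (T : topologicalType) (S : Type) (A : set T)
    (k : T -> S) :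
  connected A ->
  (forall p, A p -> \forall q \near p, A q -> k q = k p) ->
  forall p q, A p -> A q -> k p = k q.
Proof.
move=> cA lk p q Ap Aq.
have within_cst B : (forall x y, k x = k y -> B x -> B y) ->
    exists2 C, open C & A `&` B = A `&` C.
  (* Adding the complement of [A] before taking the interior turns a relatively open subset of [A]
     into the trace of an ambient open set. *)
  move=> kB; exists (A `&` B `|` ~` A)°; first exact: open_interior.
  apply/seteqP; split=> x [Ax Bx]; split=> //.
    rewrite /interior; near=> y.
    have [Ay|nAy] := pselect (A y); [left|by right].
    split=> //; apply: (kB x) => //; apply/esym.
    by move: Ay; near: y; exact: lk.
  by case: (interior_subset Bx) => [[]|].
have [C oC eC] := within_cst [set x | k x = k p] (fun x y e =>
  eq_trans (esym e)).
have [D oD eD] : exists2 D, open D &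
    A `&` [set x | k x <> k p] = A `&` D.
  by apply: within_cst => x y e /= Bx ey; apply: Bx; rewrite e.
suff : A `&` [set x | k x = k p] = A.
  by move=> AE; have : (A `&` [set x | k x = k p]) q; [rewrite AE|case].
apply: cA; first by exists p.
  by exists C.
exists (~` D); first exact: open_closedC.
apply/seteqP; split=> x [Ax kx]; split=> //.
  move=> Dx; have : (A `&` D) x by [].
  by rewrite -eD => -[].
apply: contrapT => nkx; have : (A `&` [set x | k x <> k p]) x by [].
by rewrite eD => -[].
Unshelve. all: by end_near.
Qed.

Local Open Scope group_scope.

Section Trivialization.
Context {P : topologicalType} {G : groupType} {I : Type}.
Variables (U : I -> set P) (lam : I -> P -> G).

(* The [lam j / lam i] are the transition functions of a principal G-bundle with
   discrete fibers; a flat function is a section of this bundle. *)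
Definition flat_on (A : set P) (h : P -> G) :=
  forall p, A p -> forall i, U i p ->
    \forall q \near p, A q -> h q * (lam i q)^-1 = h p * (lam i p)^-1.

Definition trivial_on (A : set P) := exists h, flat_on A h.

Hypothesis cover : forall p, exists i, U i p.
Hypothesis flat_transition : forall i j p, U i p -> U j p ->
  \forall q \near p, lam j q * (lam i q)^-1 = lam j p * (lam i p)^-1.

Lemma flat_on_mul A h g : flat_on A h -> flat_on A (fun p => g * h p).
Proof.
move=> fh p Ap i Ui; have := fh p Ap i Ui; apply: filterS => q /= fq Aq.
by rewrite -!mulgA fq.
Qed.

(** In a chart the factors [lam i] cancel in the quotient of two flat functions, so this quotient is
    locally constant; flat functions on a connected set differ by a constant left factor. *)
Lemma flat_on_unique A h h' : connected A -> flat_on A h -> flat_on A h' ->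
  forall p q, A p -> A q -> h p * (h' p)^-1 = h q * (h' q)^-1.
Proof.
move=> cA fh fh' p q Ap Aq.
apply: (@locally_constant_connected _ _ A (fun p => h p * (h' p)^-1)) Ap Aq =>
  // {p q} p Ap.
have [i Ui] := cover p.
near=> q => Aq.
have E (k : P -> G) : k q * (h' q)^-1 = k q * (lam i q)^-1 * (h' q * (lam i
  q)^-1)^-1.
  by rewrite invgM invgK mulgA mulgVK.
rewrite E.
have -> : h q * (lam i q)^-1 = h p * (lam i p)^-1.
  by move: Aq; near: q; exact: fh.
have -> : h' q * (lam i q)^-1 = h' p * (lam i p)^-1.
  by move: Aq; near: q; exact: fh'.
by rewrite invgM invgK mulgA mulgVK.
Unshelve. all: by end_near.
Qed.

Lemma trivial_chart A i : A `<=` U i -> trivial_on A.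
Proof.
move=> AU; exists (lam i) => p Ap j Uj.
have := flat_transition Uj (AU p Ap).
by apply: filterS => q ->.
Qed.

(** On the connected intersection the two sections differ by a constant left factor; after
    multiplying the second by it they agree there and can be pasted. *)
Lemma trivial_glue A B : closed A -> closed B -> connected (A `&` B) ->
  trivial_on A -> trivial_on B -> trivial_on (A `|` B).
Proof.
move=> clA clB cAB [h fh] [k fk].
have [k' [fk' ek]] : exists k', flat_on B k' /\ forall p, A p -> B p ->
  h p = k' p.
  have [[p0 [Ap0 Bp0]]|none] := pselect (exists p, A p /\ B p); last first.
    by exists k; split=> // p Ap Bp; case: none; exists p.
  exists (fun p => h p0 * (k p0)^-1 * k p); split; first exact: flat_on_mul.
  move=> p Ap Bp; have fsub C D l : C `<=` D -> flat_on D l -> flat_on C l.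
    move=> CD fl q Cq i Ui; have := fl q (CD q Cq) i Ui.
    by apply: filterS => q' fq' Cq'; exact/fq'/CD.
  have -> : h p0 * (k p0)^-1 = h p * (k p)^-1.
    apply: (flat_on_unique cAB) => //.
      by apply: fsub fh => q [].
    by apply: fsub fk => q [].
  by rewrite mulgVK.
pose l p := if `[< A p >] then h p else k' p.
have lA p : A p -> l p = h p by move=> Ap; rewrite /l asboolT.
have lB p : B p -> l p = k' p.
  rewrite /l; case: asboolP => // Ap Bp; exact: ek.
exists l => p ABp i Ui.
(* Closedness enters here: a point outside [C] has a neighbourhood missing [C], where the claim is
   void. *)
have nearC C m : closed C -> flat_on C m -> (forall q, C q -> l q = m q) ->
    \forall q \near p, C q -> l q * (lam i q)^-1 = l p * (lam i p)^-1.
  move=> clC fm lC; have [Cp|nCp] := pselect (C p).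
    have := fm p Cp i Ui; apply: filterS => q fq Cq.
    by rewrite !lC // fq.
  have : \forall q \near p, (~` C) q by exact: (open_nbhs_nbhs (conj
    (closed_openC clC) nCp)).
  by apply: filterS => q nCq /nCq.
have nA := nearC _ _ clA fh lA; have nB := nearC _ _ clB fk' lB.
by apply: filterS2 nA nB => q qA qB [/qA|/qB].
Qed.

End Trivialization.
Local Close Scope group_scope.

Section Square.
Context {R : realType}.

Definition rect (a b c d : R) : set (R * R) :=
  [set p | [/\ a <= p.1, p.1 <= b, c <= p.2 & p.2 <= d]].

Lemma rectE a b c d : rect a b c d = `[a, b]%classic `*` `[c, d]%classic.
Proof.
apply/seteqP; split=> -[x y]; rewrite /rect /= !in_itv /=.
  by case=> -> -> -> ->.
by case=> /andP[-> ->] /andP[-> ->].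
Qed.

Lemma rect_compact a b c d : compact (rect a b c d).
Proof. by rewrite rectE; apply: compact_setX; exact: segment_compact. Qed.

Lemma rect_closed a b c d : closed (rect a b c d).
Proof. by apply: (compact_closed _ (@rect_compact a b c d));
  exact: norm_hausdorff. Qed.

Lemma rect_connected a b c d : connected (rect a b c d).
Proof.
have [ab|ba] := leP a b; last first.
  have -> : rect a b c d = set0; last exact: connected0.
  by apply/seteqP; split=> // -[x y] []/= *; lra.
have [cd|dc] := leP c d; last first.
  have -> : rect a b c d = set0; last exact: connected0.
  by apply/seteqP; split=> // -[x y] []/= *; lra.
(* The rectangle is a union of combs: each vertical segment together with the bottom edge is
   connected, and all of them share the corner [(a, c)]. *)
rewrite (_ : rect _ _ _ _ =
    \bigcup_(x in `[a, b]%classic) ((pair x) @` `[c, d]%classic `|`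
      (pair^~ c) @` `[a, b]%classic)); last first.
  rewrite rectE; apply/seteqP; split=> [[x y] /= [xab ycd]|[x y] /= [z zab]].
    by exists x => //; left; exists y.
  case=> -[w wI [<- <-]]; split=> //=.
  by rewrite in_itv /= lexx cd.
apply: bigcup_connected => [|x xab].
  exists (a, c) => x _; right; exists a => //.
  by rewrite /= in_itv /= lexx ab.
have itvc (u v : R) : connected `[u, v]%classic.
  by apply/connected_intervalP/interval_is_interval.
apply: connectedU.
- exists (x, c); split; [exists c | exists x] => //.
  by rewrite /= in_itv /= lexx cd.
- apply: connected_continuous_connected => //.
  apply: continuous_subspaceT.
  exact: (continuous_pair (@cst_continuous _ _ x) continuous_idT).
- apply: connected_continuous_connected => //.
  apply: continuous_subspaceT.
  exact: (continuous_pair continuous_idT (@cst_continuous _ _ c)).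
Qed.

Lemma plane_connected : connected [set: R * R].
Proof.
have -> : [set: R * R] = \bigcup_(r in [set r : R |
  0 <= r]) rect (- r) r (- r) r.
  apply/seteqP; split=> // -[x y] _; exists (`|x| + `|y|).
    by rewrite /= addr_ge0.
  have := normr_ge0 x; have := normr_ge0 y.
  by split=> /=; have := ler_norm x; have := ler_norm (- x); have := ler_norm y;
    have := ler_norm (- y); rewrite !normrN; lra.
apply: bigcup_connected => [|r _]; last exact: rect_connected.
by exists (0, 0) => r /= r0; split=> //=; lra.
Qed.

Lemma line_connected : connected [set: R].
Proof. by apply/connected_intervalP => x y _ _ z _. Qed.

Lemma rectI a b c d a' b' c' d' : rect a b c d `&` rect a' b' c' d' =
  rect (Num.max a a') (Num.min b b') (Num.max c c') (Num.min d d').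
Proof.
apply/seteqP; split=> p /=; rewrite /rect /= !ge_max !le_min.
  by case=> -[-> -> -> ->] [-> -> -> ->].
by case=> /andP[-> ->] /andP[-> ->] /andP[-> ->] /andP[-> ->].
Qed.

Section TrivialOnSquare.
Context {G : groupType} {I : Type}.
Variables (U : I -> set (R * R)) (lam : I -> R * R -> G).
Hypothesis cover : forall p, exists i, U i p.
Hypothesis open_chart : forall i p, U i p -> \forall q \near p, U i q.
Hypothesis flat_transition : forall i j p, U i p -> U j p ->
  \forall q \near p,
    (lam j q * (lam i q)^-1 = lam j p * (lam i p)^-1)%g.

Let Z := rect 0 1 0 1.
(** Intersecting with [Z] allows arbitrary rectangles in the inductions, although compactness
    provides a uniform size only for points of the unit square. *)
Let trivial a b c d :=
  trivial_on U lam (rect a b c d `&` Z).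

(** A Lebesgue number: by compactness one radius fits every point of the square into a chart, so a
    small rectangle lies in a single chart. *)
Let trivial_small : exists2 e : R, 0 < e &
  forall a b c d, b - a <= e -> d - c <= e -> trivial a b c d.
Proof.
have /compact_near_coveringP/(_ _ (0^'+ : set_system R)
    (fun e p => exists i, rect (p.1 - e) (p.1 + e) (p.2 - e) (p.2 + e) `<=` U
      i)) :
  compact Z by exact: rect_compact.
case=> [p _|e /= e0 He].
  have [i /open_chart/nbhs_ballP[e /= e0 eU]] := cover p.
  near=> q e'.
  exists i => z /= [z1 z2 z3 z4]; apply: eU.
  have : ball p (e / 2) q by near: q; apply: nbhsx_ballx; rewrite divr_gt0.
  have e'e : e' < e / 2 by near: e'; apply: nbhs_right_lt; rewrite divr_gt0.
  move=> -[] /=; rewrite /ball /= !ltr_norml => /andP[? ?] /andP[? ?].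
  by split; rewrite /ball /= ltr_norml; apply/andP; split; lra.
exists (e / 2); first by rewrite divr_gt0.
move=> a b c d ab cd.
have [[p [rp Zp]]|none] := pselect (exists p, rect a b c d p /\ Z p);
  last first.
  have [i _] := cover (0, 0).
  apply: (trivial_chart flat_transition (i := i)) => // p [rp Zp].
  by case: none; exists p.
have be : ball (0 : R) e (e / 2) by rewrite /ball /= sub0r normrN ger0_norm;
  lra.
have e2 : 0 < e / 2 by lra.
have [i Ui] := He (e / 2) be e2 p Zp.
apply: (trivial_chart flat_transition (i := i)) => // q [[? ? ? ?] _];
  apply: Ui.
by case: rp => *; split; lra.
Unshelve. all: by end_near.
Qed.

Let trivial_split a b c d a' b' c' d' a'' b'' c'' d'' :
  rect a b c d = rect a' b' c' d' `|` rect a'' b'' c'' d'' ->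
  trivial a' b' c' d' -> trivial a'' b'' c'' d'' -> trivial a b c d.
Proof.
move=> e t1 t2; rewrite /trivial e setIUl.
apply: trivial_glue => //; rewrite /Z !rectI; [exact: rect_closed..|].
exact: rect_connected.
Qed.

Let trivial_widen1 e c d (n : nat) : 0 < e ->
  (forall a b, b - a <= e -> trivial a b c d) ->
  forall a b, b - a <= e * n%:R -> trivial a b c d.
Proof.
move=> e0 triv; elim: n => [|n IHn] a b ab.
  by apply: triv; rewrite mulr0 in ab; lra.
have [/triv//|eab] := leP (b - a) e.
apply: (@trivial_split _ _ _ _ a (b - e) c d (b - e) b c d).
- apply/seteqP; split=> p /=.
    by case=> ? ? ? ?; have [?|/ltW ?] := leP p.1 (b - e); [left|right]; split.
  by case=> -[? ? ? ?]; split=> //; lra.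
- by apply: IHn; rewrite -natr1 mulrDr in ab; lra.
- by apply: triv; lra.
Qed.

Let trivial_widen2 e a b (n : nat) : 0 < e ->
  (forall c d, d - c <= e -> trivial a b c d) ->
  forall c d, d - c <= e * n%:R -> trivial a b c d.
Proof.
move=> e0 triv; elim: n => [|n IHn] c d cd.
  by apply: triv; rewrite mulr0 in cd; lra.
have [/triv//|ecd] := leP (d - c) e.
apply: (@trivial_split _ _ _ _ a b c (d - e) a b (d - e) d).
- apply/seteqP; split=> p /=.
    by case=> ? ? ? ?; have [?|/ltW ?] := leP p.2 (d - e); [left|right]; split.
  by case=> -[? ? ? ?]; split=> //; lra.
- by apply: IHn; rewrite -natr1 mulrDr in cd; lra.
- by apply: triv; lra.
Qed.

(** Small rectangles are glued into strips and strips into the square. Two pieces always meet in a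
    rectangle, possibly degenerate or empty, so the intersections stay connected. *)
Lemma trivial_square : trivial_on U lam (rect 0 1 0 1).
Proof.
have [e e0 triv] := trivial_small.
have [n en] : exists n : nat, 1 - 0 <= e * n%:R.
  exists (Num.trunc e^-1).+1; rewrite subr0 mulrC -ler_pdivrMr // div1r.
  by apply/ltW; rewrite truncnS_gt.
suff : trivial 0 1 0 1 by rewrite /trivial /Z setIid.
apply: (trivial_widen1 e0 _ en) => a b ab.
by apply: (trivial_widen2 e0 _ en) => c d; exact: triv.
Qed.

End TrivialOnSquare.
End Square.

(** * Continuity of real expressions and syntax-directed tactics for it *)

Lemma continuous_minR (R : realType) (S : topologicalType) (a b : S -> R) :
  continuous a -> continuous b -> continuous (fun t => Num.min (a t) (b t)).
Proof. by move=> ca cb; apply: (@min_fun_continuous _ _ _ a b). Qed.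

Lemma continuous_maxR (R : realType) (S : topologicalType) (a b : S -> R) :
  continuous a -> continuous b -> continuous (fun t => Num.max (a t) (b t)).
Proof. by move=> ca cb; apply: (@max_fun_continuous _ _ _ a b). Qed.

Lemma continuousNR (R : realType) (S : topologicalType) (a : S -> R) :
  continuous a -> continuous (fun s => - a s).
Proof. by move=> ca s; apply: cvgN; exact: ca. Qed.

Lemma clampR_continuous (R : realType) : continuous (@clampR R).
Proof.
exact: (continuous_compT (@val_unitI_continuous R) (@clamp_continuous R)).
Qed.

Lemma clampR01 (R : realType) (t : R) : 0 <= clampR t <= 1.
Proof. by have := clampR_in t; rewrite mem_setE in_itv. Qed.

Lemma clampR_id (R : realType) (t : R) : 0 <= t <= 1 -> clampR t = t.
Proof. exact: val_clamp. Qed.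

Lemma clampR_le0 (R : realType) (t : R) : t <= 0 -> clampR t = 0.
Proof. by move=> t0; rewrite /clampR min_l ?max_l //; lra. Qed.

Lemma clampR_ge1 (R : realType) (t : R) : 1 <= t -> clampR t = 1.
Proof. by move=> t1; rewrite /clampR min_r ?max_r //; lra. Qed.

Ltac real_continuous_at f :=
  lazymatch f with
  | (fun _ => ?c) => exact: cst_continuous
  | (fun s => s) => exact: continuous_idT
  | (fun s => (@?a s, @?b s)) => refine (continuous_pair (a := a) (b := b) _ _)
  | (fun s => (@?a s + @?b s)%R) => refine (continuousDR (a := a) (b := b) _ _)
  | (fun s => (- @?a s)%R) => refine (continuousNR (a := a) _)
  | (fun s => (@?a s * @?b s)%R) => refine (continuousMR (a := a) (b := b) _ _)
  | (fun s => Order.min (@?a s) (@?b s)) => refine (continuous_minR (a := a) (b := b) _ _)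
  | (fun s => Order.max (@?a s) (@?b s)) => refine (continuous_maxR (a := a) (b := b) _ _)
  | (fun s => fst (@?a s)) => refine (continuous_compT (g := fst) (a := a) continuous_fstT _)
  | (fun s => snd (@?a s)) => refine (continuous_compT (g := snd) (a := a) continuous_sndT _)
  | (fun s => ?g (@?a s)) => refine (continuous_compT (g := g) (a := a) _ _)
  | (?g \o ?a) => refine (continuous_compT (g := g) (a := a) _ _)
  | cst _ => exact: cst_continuous
  | @clampR _ => exact: clampR_continuous
  | id => exact: continuous_idT
  | fst => exact: continuous_fstT
  | snd => exact: continuous_sndT
  end.
Ltac continuous_hyp :=
  match goal with c : forall x, continuous_at x ?g |- forall x, continuous_at x ?f =>
    let f' := eval cbv beta in f in constr_eq_nounivs f' g; exact: c end.
Ltac real_continuous_step :=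
  first [ continuous_hyp | lazymatch goal with |- forall x, continuous_at x ?f =>
    let f' := eval cbv beta in f in real_continuous_at f' end
  | assumption ].
Ltac real_continuous := solve [repeat real_continuous_step].

(** * Loops and change of base point *)

Section LoopClasses.
Context {R : realType} {T : topologicalType}.
Implicit Types (x : T) (F : R -> T).

Definition is_loop x F := [/\ continuous F, F 0 = x & F 1 = x].

Section MakeLoop.
Variables (x : T) (F : R -> T).
Hypothesis FP : is_loop x F.

Let loop_cont : continuous (fun t : unitI R => F (val t)).
Proof. by have [cF _ _] := FP; cont. Qed.
Let loop_zero : F (val (zero : unitI R)) = x.
Proof. by rewrite val_zero; have [] := FP. Qed.
Let loop_one : F (val (one : unitI R)) = x.
Proof. by rewrite val_one; have [] := FP. Qed.

Definition mk_loop : {path unitI R from x to x in T} :=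
  mk_path loop_cont loop_zero loop_one.

Lemma mk_loopE t : 0 <= t <= 1 -> loop_line mk_loop t = F t.
Proof. by move=> tI; rewrite -[in RHS](val_clamp tI). Qed.
End MakeLoop.

(* The junk value is 1 if F is not a loop at x. *)
Definition pi1_of x F : pi1 R x :=
  if pselect (is_loop x F) is left FP then pi1_class (mk_loop FP) else 1%g.

Lemma loop_line_is_loop x (f : {path unitI R from x to x in T}) :
  is_loop x (loop_line f).
Proof.
by split; [exact: loop_line_continuous|exact: loop_line_le0|exact: loop_line_ge1].
Qed.

Lemma pi1_ofE x F (f : {path unitI R from x to x in T}) :
  is_loop x F -> (forall t : R, 0 <= t <= 1 -> loop_line f t = F t) ->
  pi1_of x F = pi1_class f.
Proof.
rewrite /pi1_of; case: pselect => // FP _ fF; congr (pi1_class _).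
apply/path_eqP => t; rewrite -[RHS]loop_lineE fF //.
by rewrite unitI_ge0 unitI_le1.
Qed.

Lemma pi1_of_line x (f : {path unitI R from x to x in T}) :
  pi1_of x (loop_line f) = pi1_class f.
Proof. by apply: pi1_ofE => //; exact: loop_line_is_loop. Qed.

Lemma pi1_of_homotopy x F G (H : R * R -> T) :
  is_loop x F -> is_loop x G -> continuous H ->
  (forall t : R, 0 <= t <= 1 -> H (t, 0) = F t) ->
  (forall t : R, 0 <= t <= 1 -> H (t, 1) = G t) ->
  (forall s : R, 0 <= s <= 1 -> H (0, s) = x) ->
  (forall s : R, 0 <= s <= 1 -> H (1, s) = x) ->
  pi1_of x F = pi1_of x G.
Proof.
move=> FP GP cH HF HG H0 H1.
rewrite (pi1_ofE FP (mk_loopE FP)) (pi1_ofE GP (mk_loopE GP)).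
apply/pi1_classP; apply: (homotopic_intro cH) => // t tI.
  by rewrite HF ?mk_loopE.
by rewrite HG ?mk_loopE.
Qed.

Lemma pi1_class_homotopy x (f g : {path unitI R from x to x in T}) :
  pi1_class f = pi1_class g -> exists H : R * R -> T, [/\ continuous H,
  (forall t s, s <= 0 -> H (t, s) = loop_line f t),
  (forall t s, 1 <= s -> H (t, s) = loop_line g t),
  (forall t s, t <= 0 -> H (t, s) = x) &
  (forall t s, 1 <= t -> H (t, s) = x)].
Proof. by move/pi1_classP/homotopic_elim. Qed.

(** The parameters [p] and [q] are joined by the straight homotopy in the line, where [K] is defined
    everywhere. *)
Lemma pi1_of_reparam x (K : R -> T) (p q : R -> R) :
  is_loop x (K \o p) -> continuous K -> continuous p -> continuous q ->
  p 0 = q 0 -> p 1 = q 1 -> pi1_of x (K \o p) = pi1_of x (K \o q).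
Proof.
move=> [ckp k0 k1] cK cp cq e0 e1.
apply: (@pi1_of_homotopy _ _ _ (fun z => K (p z.1 + z.2 * (q z.1 - p z.1)))) =>
  //=.
- by split=> //=; [real_continuous|rewrite -e0|rewrite -e1].
- by real_continuous.
- by move=> t _; rewrite mul0r addr0.
- by move=> t _; rewrite mul1r subrKC.
- by move=> s _; rewrite -e0 subrr mulr0 addr0.
- by move=> s _; rewrite -e1 subrr mulr0 addr0.
Qed.

Lemma pi1_of_reparam2 x (K : R * R -> T) (p1 p2 q1 q2 : R -> R) :
  is_loop x (fun t => K (p1 t, p2 t)) -> continuous K ->
  continuous p1 -> continuous p2 -> continuous q1 -> continuous q2 ->
  p1 0 = q1 0 -> p2 0 = q2 0 -> p1 1 = q1 1 -> p2 1 = q2 1 ->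
  pi1_of x (fun t => K (p1 t, p2 t)) = pi1_of x (fun t => K (q1 t, q2 t)).
Proof.
move=> [ckp k0 k1] cK cp1 cp2 cq1 cq2 e10 e20 e11 e21.
apply: (@pi1_of_homotopy _ _ _ (fun z => K (p1 z.1 + z.2 * (q1 z.1 - p1 z.1),
    p2 z.1 + z.2 * (q2 z.1 - p2 z.1)))) => //=.
- by split=> //=; [real_continuous|rewrite -e10 -e20|rewrite -e11 -e21].
- by real_continuous.
- by move=> t _; rewrite !mul0r !addr0.
- by move=> t _; rewrite !mul1r !subrKC.
- by move=> s _; rewrite -e10 -e20 !subrr !mulr0 !addr0.
- by move=> s _; rewrite -e11 -e21 !subrr !mulr0 !addr0.
Qed.

Lemma pi1_of_cst x : pi1_of x (cst x) = 1%g.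
Proof.
by rewrite (@pi1_ofE _ _ (const_loop x)) //; split=> //; exact: cst_continuous.
Qed.

Definition subpath F (a b : R) : R -> T := fun t => F (a + t * (b - a)).

Lemma subpath_is_loop x F a b :
  continuous F -> F a = x -> F b = x -> is_loop x (subpath F a b).
Proof.
move=> cF Fa Fb; split; rewrite /subpath; first by real_continuous.
  by rewrite mul0r addr0.
by rewrite mul1r subrKC.
Qed.

Lemma subpath01 F : subpath F 0 1 = F.
Proof. by apply/funext => t; rewrite /subpath subr0 mulr1 add0r. Qed.

Lemma pi1_of_cat x F G E : is_loop x F -> is_loop x G -> is_loop x E ->
  (forall t : R, 0 <= t <= 1 -> 2 * t - 1 <= 0 -> E t = F (2 * t)) ->
  (forall t : R, 0 <= t <= 1 -> 2 * t - 1 > 0 -> E t = G (2 * t - 1)) ->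
  pi1_of x E = (pi1_of x F * pi1_of x G)%g.
Proof.
move=> FP GP EP EF EG.
rewrite (pi1_ofE FP (mk_loopE FP)) (pi1_ofE GP (mk_loopE GP)).
rewrite -[(_ * _)%g]pi1_class_concat; apply: pi1_ofE => // t tI.
rewrite concat_line; case: ifPn => t0.
  by rewrite EF // mk_loopE //; lra.
by rewrite -ltNge in t0; rewrite EG // mk_loopE //; lra.
Qed.

(** The numbers [a], [b], [c] come in any order: both sides are [F] along parameters from [a] to
    [c], one straight and one passing through [b]. This is what permits negative numbers of turns
    later. *)
Lemma pi1_subpath_cat x F a b c :
  continuous F -> F a = x -> F b = x -> F c = x ->
  pi1_of x (subpath F a c) =
  (pi1_of x (subpath F a b) * pi1_of x (subpath F b c))%g.
Proof.
move=> cF Fa Fb Fc.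
pose q (t : R) := a + Num.min (2 * t) 1 * (b - a) + Num.max (2 * t - 1) 0 * (c -
  b).
have cq : continuous q by rewrite /q; real_continuous.
have q0 : q 0 = a by rewrite /q min_l ?max_r; lra.
have q1 : q 1 = c by rewrite /q min_r ?max_l; lra.
have Fq : is_loop x (F \o q) by split; rewrite /= ?q0 ?q1 //; real_continuous.
rewrite -(@pi1_of_cat x _ _ (F \o q)).
- rewrite (_ : subpath F a c = F \o (fun t => a + t * (c - a))) //.
  apply: pi1_of_reparam => //; first exact: subpath_is_loop.
  + by real_continuous.
  + by rewrite q0 mul0r addr0.
  + by rewrite q1 mul1r subrKC.
- exact: subpath_is_loop.
- exact: subpath_is_loop.
- by [].
- move=> t _ t0; rewrite /= /q min_l; last lra.
  by rewrite max_r // /subpath; congr F; lra.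
- move=> t _ t0; rewrite /= /q min_r; last lra.
  by rewrite max_l; [rewrite /subpath; congr F; lra | lra].
Qed.

End LoopClasses.

Section ChangeOfBase.
Context {R : realType} {T : topologicalType}.
Implicit Types (g : R -> T).

Definition freely_homotopic g (F E : R -> T) := exists K : R * R -> T,
  [/\ continuous K,
    forall t : R, 0 <= t <= 1 -> K (t, 0) = F t,
    forall t : R, 0 <= t <= 1 -> K (t, 1) = E t,
    forall s : R, 0 <= s <= 1 -> K (0, s) = g s &
    forall s : R, 0 <= s <= 1 -> K (1, s) = g s].

Lemma freely_homotopic_sym g F E :
  freely_homotopic g F E -> freely_homotopic (fun s => g (1 - s)) E F.
Proof.
case=> K [cK KF KE K0 K1]; exists (fun z => K (z.1, 1 - z.2)).
split=> [|t tI|t tI|s sI|s sI] /=; first by real_continuous.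
- by rewrite subr0 KE.
- by rewrite subrr KF.
- by rewrite K0 //; lra.
- by rewrite K1 //; lra.
Qed.

(* The top side of a square is homotopic to its other three sides; here K is
   extended below by a contraction M of its bottom side. *)
Lemma freely_homotopic_trivial g F E : continuous g ->
  is_loop (g 0) F -> is_loop (g 1) E -> freely_homotopic g F E ->
  pi1_of (g 0) F = 1%g -> pi1_of (g 1) E = 1%g.
Proof.
move=> cg FP EP [K [cK KF KE K0 K1]].
rewrite (pi1_ofE FP (mk_loopE FP)) -[1%g]/(pi1_class (const_loop _)).
move=> /pi1_class_homotopy[J [cJ JF Jc J0 J1]].
pose M (z : R * R) := if z.2 <= 0 then J (clampR z.1, - z.2)
  else K (clampR z.1, clampR z.2).
have cM : continuous M.
  apply: (@paste_continuous R _ _ (fun z : R * R => z.2)) => //.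
  - by real_continuous.
  - rewrite (_ : (fun _ => _) = fun z : R * R => J (clampR z.1, 0 - z.2)).
      by real_continuous.
    by apply/funext => z; rewrite sub0r.
  - by real_continuous.
  - move=> z /= ->; rewrite oppr0 JF // [clampR 0]clampR_le0 // KF ?clampR01 //.
    by rewrite mk_loopE ?clampR01.
pose mu s := g (clampR s).
(* Height of the path around three sides: it falls from 1 to -1 on the first third, stays at -1, and
   climbs back on the last third, while [clampR (3 * t - 1)] moves only in the middle third. At
   height -1 the map [M] is constant, so the path only retraces [mu]. *)
pose sg (t : R) := Num.max (-1) (Num.max (1 - 6 * t) (6 * t - 5)).
have csg : continuous sg.
  by do 2 (refine (continuous_maxR _ _); first by cont); real_continuous.
have sg0 : sg 0 = 1 by rewrite /sg max_r // ?le_max ?max_l; lra.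
have sg1 : sg 1 = 1 by rewrite /sg max_r // ?le_max ?max_r; lra.
have M0 (t s : R) : t = 0 \/ t = 1 -> M (t, s) = mu s.
  move=> t01; rewrite /M /mu /=; case: ifPn => s0.
    rewrite [clampR s]clampR_le0 //; case: t01 => ->.
      by rewrite clampR_le0 ?J0.
    by rewrite clampR_ge1 ?J1.
  case: t01 => ->; first by rewrite [clampR 0]clampR_le0 ?K0 ?clampR01.
  by rewrite [clampR 1]clampR_ge1 ?K1 ?clampR01.
have Mlow (t s : R) : s <= -1 -> M (t, s) = g 0.
  by move=> s1; rewrite /M /= ifT ?Jc //; lra.
have mulow s : s <= 0 -> mu s = g 0 by move=> s0; rewrite /mu clampR_le0.
have muhigh : mu 1 = g 1 by rewrite /mu clampR_id // lexx ler01.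
have EM : pi1_of (g 1) E = pi1_of (g 1) (fun t => M (t, 1)).
  apply: (@pi1_of_homotopy _ _ _ _ _ (fun z => M (z.1, 1))) => //=.
  - split; [by real_continuous|by rewrite M0 //; left|by rewrite M0 //; right].
  - by real_continuous.
  - by move=> t tI; rewrite /M /= ifF ?clampR_id ?KE ?lexx ?ler01 //; lra.
  - by move=> s _; rewrite M0 //; left.
  - by move=> s _; rewrite M0 //; right.
rewrite EM (@pi1_of_reparam2 _ _ _ M id (cst 1) (fun t =>
  clampR (3 * t - 1)) sg) //.
- rewrite -[RHS](pi1_of_cst (R := R)).
  rewrite -[cst (g 1)](_ : mu \o cst 1 = _); last first.
    by apply/funext => t /=; rewrite muhigh.
  have -> : pi1_of (g 1) (fun t => M (clampR (3 * t - 1), sg t)) =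
            pi1_of (g 1) (mu \o sg).
    apply: (@pi1_of_homotopy _ _ _ _ _ (fun z => mu (sg z.1))).
    + split; [by real_continuous| |].
        by rewrite sg0 M0 //; left; rewrite clampR_le0 //; lra.
      by rewrite sg1 M0 //; right; rewrite clampR_ge1 //; lra.
    + by split; rewrite /= /mu ?sg0 ?sg1 -/(mu 1) ?muhigh //; real_continuous.
    + by rewrite /mu; real_continuous.
    + move=> t tI /=.
      have [t1|t1] := leP (3 * t) 1.
        by rewrite M0 //; left; rewrite clampR_le0 //; lra.
      have [t2|t2] := leP 2 (3 * t).
        rewrite M0 //; right; rewrite clampR_ge1 //; lra.
      have -> : sg t = -1.
        by rewrite /sg max_l // ge_max; apply/andP; split; lra.
      by rewrite Mlow ?mulow //; lra.
    + by [].
    + by move=> s _; rewrite /= sg0.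
    + by move=> s _; rewrite /= sg1.
  apply: pi1_of_reparam => //.
  + by split; rewrite /= /mu ?sg0 ?sg1 -/(mu 1) ?muhigh //; real_continuous.
  + by rewrite /mu; real_continuous.
  + by real_continuous.
- by split; [real_continuous|by rewrite M0 //; left|by rewrite M0 //; right].
- by real_continuous.
- by real_continuous.
- by real_continuous.
- by rewrite clampR_le0 //; lra.
- by rewrite clampR_ge1 //; lra.
Qed.

(** Kept as a relation on classes, so that representatives can be chosen freely; it becomes a map by
    choice once totality and functionality are known. *)
Definition conj_along x y g (u : pi1 R x) (v : pi1 R y) := exists f e,
  [/\ u = pi1_class f, v = pi1_class e &
      freely_homotopic g (loop_line f) (loop_line e)].

Lemma conj_along_sym x y g (u : pi1 R x) (v : pi1 R y) :
  conj_along g u v -> conj_along (fun s => g (1 - s)) v u.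
Proof.
by case=> f [e [-> -> fe]]; exists e, f; split=> //;
  exact: freely_homotopic_sym.
Qed.

Lemma conj_along_total x y g (u : pi1 R x) : continuous g -> g 0 = x ->
  g 1 = y ->
  exists v : pi1 R y, conj_along g u v.
Proof.
move=> cg g0 g1; rewrite -(pi1_classK u); move: (repr u) => {u} f.
pose L (t : R) := if t <= 0 then g (- t) else
  if t - 1 <= 0 then loop_line f t else g (t - 1).
have cf := @loop_line_continuous _ _ _ f.
have cL : continuous L.
  apply: (@paste_continuous R _ _ (fun t : R => t));
    [by real_continuous|by real_continuous| |].
    apply: (@paste_continuous R _ _ (fun t : R => t - 1));
      [by real_continuous|by real_continuous|by real_continuous|].
    by move=> t t1; rewrite t1 loop_line_ge1 ?g0 //; lra.
  by move=> t ->; rewrite oppr0 ifT ?loop_line_le0 ?g0 //; lra.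
have L0 (s : R) : 0 <= s -> L (- s) = g s.
  by move=> s0; rewrite /L ifT ?opprK //; lra.
have L1 (s : R) : 0 <= s -> L (1 + s) = g s.
  move=> s0; rewrite /L ifF; last lra.
  case: ifP => s1; last by congr g; lra.
  by rewrite loop_line_ge1 -?g0; [congr g|]; lra.
(* [L] is [g] backwards, then the loop, then [g]. At time [s] the parameter runs over [[-s, 1 + s]],
   so both ends move along [g]. *)
pose K (z : R * R) := L ((1 + 2 * z.2) * z.1 - z.2).
have cK : continuous K by rewrite /K; real_continuous.
have K0 (s : R) : 0 <= s <= 1 -> K (0, s) = g s.
  by move=> /andP[s0 _]; rewrite /K /= mulr0 sub0r L0.
have K1 (s : R) : 0 <= s <= 1 -> K (1, s) = g s.
  by move=> /andP[s0 _]; rewrite -L1 // /K /=; congr L; lra.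
have EP : is_loop y (fun t => K (t, 1)).
  by split; [real_continuous|rewrite K0 ?g1|rewrite K1 ?g1];
    rewrite ?ler01 ?lexx.
exists (pi1_class (mk_loop EP)), f, (mk_loop EP); split=> //.
exists K; split=> // t tI; last by rewrite mk_loopE.
rewrite /K /= mulr0 addr0 mul1r subr0 /L; case: ifP => t0.
  by rewrite loop_line_le0 // -g0; congr g; lra.
by rewrite ifT //; lra.
Qed.

Lemma conj_alongM x y g (u u' : pi1 R x) (v v' : pi1 R y) : g 0 = x ->
  g 1 = y ->
  conj_along g u v -> conj_along g u' v' -> conj_along g (u * u')%g (v * v')%g.
Proof.
move=> g0 g1.
case=> f [e [-> -> [K [cK Kf Ke K0 K1]]]] [f' [e' [-> ->
  [K' [cK' Kf' Ke' K0' K1']]]]].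
exists (concat f f'), (concat e e'); split; rewrite ?pi1_class_concat //.
pose M (z : R * R) := if 2 * z.1 - 1 <= 0 then K (2 * z.1, clampR z.2)
  else K' (2 * z.1 - 1, clampR z.2).
exists M; split=> [|t tI|t tI|s sI|s sI]; rewrite /M /=.
- apply: (@paste_continuous R _ _ (fun z : R * R => 2 * z.1 - 1));
  [by real_continuous..|].
  move=> z z0; rewrite z0 K0' ?clampR01 // (_ : 2 * z.1 = 1); last lra.
  by rewrite K1 ?clampR01.
- rewrite concat_line clampR_le0 //; case: ifP => t0; first by rewrite Kf //;
  lra.
  by rewrite Kf' //; lra.
- rewrite concat_line clampR_ge1 //; case: ifP => t0; first by rewrite Ke //;
  lra.
  by rewrite Ke' //; lra.
- by rewrite ifT ?mulr0 ?clampR_id ?K0 //; lra.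
- rewrite ifF; last lra.
  by rewrite (_ : 2 * 1 - 1 = 1) ?clampR_id ?K1' //; lra.
Qed.

Lemma conj_alongV x y g (u : pi1 R x) (v : pi1 R y) :
  conj_along g u v -> conj_along g u^-1%g v^-1%g.
Proof.
case=> f [e [-> -> [K [cK Kf Ke K0 K1]]]].
exists (reverse f), (reverse e); split; rewrite ?pi1_class_reverse //.
exists (fun z => K (1 - z.1, z.2)); split=> [|t tI|t tI|s sI|s sI] /=.
- by real_continuous.
- by rewrite reverse_line Kf //; lra.
- by rewrite reverse_line Ke //; lra.
- by rewrite subr0 K1.
- by rewrite subrr K0.
Qed.

Lemma conj_along_trivial x y g (v : pi1 R y) : continuous g ->
  g 0 = x -> g 1 = y -> conj_along g (1%g : pi1 R x) v -> v = 1%g.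
Proof.
move=> cg g0 g1; subst x y.
case=> f [e [f1 -> K]]; rewrite -pi1_of_line.
apply: (freely_homotopic_trivial cg (F := loop_line f)) => //.
- exact: loop_line_is_loop.
- exact: loop_line_is_loop.
- by rewrite pi1_of_line.
Qed.

(** The relation is multiplicative, so [v^-1 * v'] corresponds to [u^-1 * u], and a conjugate of the
    trivial class is trivial. *)
Lemma conj_along_functional x y g (u : pi1 R x) (v v' : pi1 R y) : continuous g
  ->
  g 0 = x -> g 1 = y -> conj_along g u v -> conj_along g u v' -> v = v'.
Proof.
move=> cg g0 g1 uv uv'; apply/esym/(mulgI v^-1%g); rewrite [RHS]mulVg.
apply: (conj_along_trivial cg g0 g1); rewrite -(mulVg u).
by apply: conj_alongM => //; exact: conj_alongV.
Qed.

Lemma pi1_change_of_base x y g : continuous g -> g 0 = x -> g 1 = y ->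
  exists2 Phi : pi1 R x -> pi1 R y,
    {morph Phi : u v / (u * v)%g} & bijective Phi.
Proof.
move=> cg g0 g1; pose g' s := g (1 - s).
have cg' : continuous g' by rewrite /g'; real_continuous.
have g'0 : g' 0 = y by rewrite /g' subr0.
have g'1 : g' 1 = x by rewrite /g' subrr.
have /choice[Phi PhiP] := fun u : pi1 R x => conj_along_total u cg g0 g1.
have /choice[Psi PsiP] := fun v : pi1 R y => conj_along_total v cg' g'0 g'1.
exists Phi => [u v|].
  by apply: (conj_along_functional cg g0 g1 (PhiP _)); exact: conj_alongM.
have gE : (fun s => g' (1 - s)) = g.
  by apply/funext => s; rewrite /g' subKr.
exists Psi => [u|v].
  apply: (conj_along_functional cg' g'0 g'1 (PsiP _)).
  exact: (conj_along_sym (PhiP u)).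
apply: (conj_along_functional cg g0 g1 (PhiP _)).
by have := conj_along_sym (PsiP v); rewrite gE.
Qed.

End ChangeOfBase.

(** * Arguments of complex functions *)

Section ComplexContinuity.
Context {R : realType}.
Local Notation C := R[i]^o.

Lemma Re_continuous : continuous (@complex.Re R : C -> R).
Proof.
move=> z; move=> A /nbhs_ballP[e /= e0 eA]; apply/nbhs_ballP.
exists e%:C => [|w]; rewrite /= ?ltcR // -ball_normE /= => zw; apply: eA.
move: zw; rewrite -ball_normE /=.
rewrite normc_def ltcR; apply: le_lt_trans.
rewrite -raddfB -sqrtr_sqr ler_wsqrtr // lerDl sqr_ge0 //.
Qed.

Lemma Im_continuous : continuous (@complex.Im R : C -> R).
Proof.
move=> z; move=> A /nbhs_ballP[e /= e0 eA]; apply/nbhs_ballP.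
exists e%:C => [|w]; rewrite /= ?ltcR // -ball_normE /= => zw; apply: eA.
move: zw; rewrite -ball_normE /=.
rewrite normc_def ltcR; apply: le_lt_trans.
rewrite -raddfB -sqrtr_sqr ler_wsqrtr // lerDr sqr_ge0 //.
Qed.

Lemma Complex_continuous (S : topologicalType) (a b : S -> R) :
  continuous a -> continuous b -> continuous (fun s => a s +i* b s : C).
Proof.
move=> ca cb s; apply/cvgrPdist_lt => -[e e'] /=; rewrite ltcE /= =>
  /andP[/eqP -> e0].
have e2 : 0 < e / 2 by rewrite divr_gt0.
have /cvgrPdist_lt/(_ _ e2) na := ca s.
have /cvgrPdist_lt/(_ _ e2) nb := cb s.
apply: filterS2 na nb => w l1 l2; rewrite normc_def ltcR /=.
rewrite -[e]ger0_norm ?ltW // -sqrtr_sqr ltr_sqrt ?exprn_gt0 //.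
rewrite -[X in X + _]real_normK ?num_real // -[X in _ + X]real_normK ?num_real
  //.
by have := normr_ge0 (a s - a w); have := normr_ge0 (b s - b w); nra.
Qed.

Section Operations.
Context {S : topologicalType}.
Implicit Types a b : S -> C.

Lemma continuousDC a b : continuous a -> continuous b -> continuous (fun s =>
  a s + b s : C).
Proof. by move=> ca cb s; apply: cvgD; [exact: ca | exact: cb]. Qed.

Lemma continuousNC a : continuous a -> continuous (fun s => - a s : C).
Proof. by move=> ca s; apply: cvgN; exact: ca. Qed.

Lemma continuousMC a b : continuous a -> continuous b -> continuous (fun s =>
  a s * b s : C).
Proof. by move=> ca cb s; apply: cvgM; [exact: ca | exact: cb]. Qed.

End Operations.

End ComplexContinuity.

Section UnitCircle.
Context {R : realType}.
Local Notation C := R[i]^o.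

Definition expi (t : R) : R[i] := cos t +i* sin t.

Lemma expiD s t : expi (s + t) = expi s * expi t.
Proof. by rewrite /expi cosD sinD; simpc; congr Complex; rewrite addrC. Qed.

Lemma expi0 : expi 0 = 1. Proof. by rewrite /expi cos0 sin0. Qed.

Lemma expi_neq0 t : expi t != 0.
Proof.
apply/eqP => e0; have := expiD t (- t).
by rewrite subrr expi0 e0 mul0r => /eqP; rewrite oner_eq0.
Qed.

Lemma expiN t : expi (- t) = (expi t)^-1.
Proof.
by apply: (mulfI (expi_neq0 t)); rewrite -expiD subrr expi0 mulfV // expi_neq0.
Qed.

Lemma expiB s t : expi (s - t) = expi s / expi t.
Proof. by rewrite expiD expiN. Qed.

Lemma expi_pi : expi pi = -1.
Proof. by rewrite /expi cospi sinpi; apply/eqP;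
  rewrite eq_complex /= oppr0 !eqxx. Qed.

Lemma expi_2pi_int (n : int) : expi (n%:~R * (2 * pi)) = 1.
Proof.
have e2 : expi (2 * pi) = 1 by rewrite mulr_natl mulr2n expiD expi_pi mulrNN
  mulr1.
have En (m : nat) : expi (m%:R * (2 * pi)) = 1.
  elim: m => [|m IHm]; first by rewrite mul0r expi0.
  by rewrite -natr1 mulrDl mul1r expiD IHm e2 mulr1.
case: n => n; first exact: En.
by rewrite NegzE mulrNz mulNr expiN [_%:~R]/(_%:R) En invr1.
Qed.

(** Used to turn a small change of argument that leaves the direction unchanged into no change at
    all. It rests on the injectivity of [cos] on [[0, pi]]. *)
Lemma expi_eq1_small t : - pi <= t -> t < pi -> expi t = 1 -> t = 0.
Proof.
move=> t1 t2 [c1 s0].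
have cn : cos `|t| = cos 0 by rewrite cos_norm c1 cos0.
have /eqP : `|t| = 0.
  apply: cos_inj cn; rewrite in_itv /= ?lexx ?pi_ge0 //.
  by rewrite normr_ge0 /= ler_norml t1 ltW.
by rewrite normr_eq0 => /eqP.
Qed.

Lemma expi_eq1 t : expi t = 1 -> exists n : int, t = n%:~R * (2 * pi).
Proof.
move=> t1; have p0 := @pi_gt0 R.
(* Rounding to the nearest integer leaves a remainder in [[-pi, pi[]. *)
pose n := Num.floor (t / (2 * pi) + 2^-1); exists n.
have /andP[] := floor_itv (t / (2 * pi) + 2^-1); rewrite -/n => n1 n2.
have e : t = t / (2 * pi) * (2 * pi) by rewrite divfK // mulf_neq0 // gt_eqF.
set u := t / (2 * pi) in n1 n2 e; rewrite intrD in n2.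
apply/eqP; rewrite -subr_eq0; apply/eqP/expi_eq1_small.
- by rewrite {1}e; nra.
- by rewrite {1}e; nra.
- by rewrite expiD t1 expiN expi_2pi_int invr1 mulr1.
Qed.

Lemma expi_continuous : continuous (expi : R -> C).
Proof. by apply: Complex_continuous;
  [exact: continuous_cos|exact: continuous_sin]. Qed.

Lemma normc_expi t : normc (expi t) = 1.
Proof. by rewrite /= cos2Dsin2 sqrtr1. Qed.

Lemma normc_real (r : R) : 0 <= r -> normc r%:C = r.
Proof. by move=> r0; rewrite /= expr0n addr0 sqrtr_sqr ger0_norm. Qed.

Lemma normc_gt0 (z : R[i]) : z != 0 -> 0 < normc z.
Proof.
move=> z0; have : 0 < `|z| by rewrite normr_gt0.
by case: z {z0} => a b; rewrite normc_def ltcR.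
Qed.

Lemma normc_continuous : continuous (@normc R : C -> R).
Proof.
have -> : @normc R = fun z : C => Num.sqrt (complex.Re z * complex.Re z +
  complex.Im z * complex.Im z).
  by apply/funext => -[a b]; rewrite /= !expr2.
apply: (continuous_compT (@sqrt_continuous R)).
have := @Re_continuous R; have := @Im_continuous R => ci cr.
by real_continuous.
Qed.

(** The branch of the argument with values within pi/2 of [a], meaningful on the open half-plane
    facing the direction [a]. These half-planes are the charts for lifting arguments. *)
Definition arg_in (a : R) (z : R[i]) : R :=
  let w := z * expi (- a) in a + atan (complex.Im w / complex.Re w).

Lemma arg_inE a z : 0 < complex.Re (z * expi (- a)) ->
  z = (normc z)%:C * expi (arg_in a z).
Proof.
rewrite /arg_in expiD.
have nz : normc z = normc (z * expi (- a)) by rewrite normcM normc_expi mulr1.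
rewrite nz; set w := z * _ => w0.
have zE : z = w * expi a by rewrite /w expiN divfK ?expi_neq0.
rewrite {1}zE mulrCA [RHS]mulrC; congr (_ * _); rewrite mulrC.
move: w0; case: {nz zE} w => u v /= u0.
set x := v / u; have s0 : 0 < Num.sqrt (1 + x ^+ 2).
  by rewrite sqrtr_gt0 ltr_wpDr ?sqr_ge0.
have cx := cos_atan x; have sx : sin (atan x) = x * cos (atan x).
  rewrite -{2}[x](atanK) /tan divfK // cx invr_eq0 gt_eqF //.
rewrite /expi sx cx.
have -> : Num.sqrt (u ^+ 2 + v ^+ 2) = u * Num.sqrt (1 + x ^+ 2).
  rewrite -[u in RHS]ger0_norm ?ltW // -sqrtr_sqr -sqrtrM ?sqr_ge0 //.
  by congr Num.sqrt; rewrite /x expr_div_n; field; rewrite gt_eqF.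
simpc; congr Complex; rewrite /x; field; rewrite ?gt_eqF //.
Qed.

Lemma arg_in_continuous (S : topologicalType) (a : R) (z : S -> C) s :
  continuous z -> 0 < complex.Re (z s * expi (- a)) ->
  {for s, continuous (fun t => arg_in a (z t))}.
Proof.
move=> cz z0; apply: cvgD; first exact: cvg_cst.
apply: continuous_comp; last exact: continuous_atan.
have cw : continuous (fun t => z t * expi (- a) : C).
  by refine (continuousMC (a := z) (b := fun=> expi (- a)) cz _);
    exact: cst_continuous.
apply: cvgM; first exact: (continuous_compT (@Im_continuous R) cw).
apply: cvgV; first by rewrite gt_eqF.
exact: (continuous_compT (@Re_continuous R) cw).
Qed.

Lemma arg_in_cover (z : R[i]) : z != 0 ->
  exists a, 0 < complex.Re (z * expi (- a)).
Proof.
move=> z0.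
have [z1|z1|z1] := ltgtP 0 (complex.Re z).
- by exists 0; rewrite oppr0 expi0 mulr1.
- by exists pi; rewrite expiN expi_pi invrN1 mulrN1 raddfN /= oppr_gt0.
have [z2|z2|z2] := ltgtP 0 (complex.Im z).
- exists (pi / 2); rewrite /expi cosN sinN cos_pihalf sin_pihalf.
  by case: z {z0 z1} z2 => u v /=; rewrite mulr0 mulrN1 sub0r opprK.
- exists (- (pi / 2)); rewrite opprK /expi cos_pihalf sin_pihalf.
  by case: z {z0 z1} z2 => u v /= v0; rewrite mulr0 mulr1 sub0r oppr_gt0.
by case/eqP: z0; case: z z1 z2 => u v /= <- <-.
Qed.

End UnitCircle.

Section ClampedSquare.
Context {R : realType}.

Definition clamp2 (p : R * R) : R * R := (clampR p.1, clampR p.2).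

Lemma clamp2_continuous : continuous clamp2.
Proof. by rewrite /clamp2; real_continuous. Qed.

Lemma clamp2_rect p : rect 0 1 0 1 (clamp2 p).
Proof.
by case: p => x y; have /andP[? ?] := clampR01 x; have /andP[? ?] := clampR01 y.
Qed.

Context {G : groupType} {I : Type}.
Variables (U : I -> set (R * R)) (lam : I -> R * R -> G).
Hypothesis cover : forall p, exists i, U i p.
Hypothesis open_chart : forall i p, U i p -> \forall q \near p, U i q.
Hypothesis flat_transition : forall i j p, U i p -> U j p ->
  \forall q \near p,
    (lam j q * (lam i q)^-1 = lam j p * (lam i p)^-1)%g.

(** Composing with the retraction [clamp2] extends the section from the closed square to the plane,
    so that flatness holds on full neighbourhoods and no boundary remains. *)
Lemma clamped_trivial : exists h : R * R -> G, forall i p, U i (clamp2 p) ->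
  \forall q \near p, (h q * (lam i (clamp2 q))^-1 =
                      h p * (lam i (clamp2 p))^-1)%g.
Proof.
have [h fh] := trivial_square cover open_chart flat_transition.
exists (h \o clamp2) => i p Ui.
have nf : \forall q \near p, rect 0 1 0 1 (clamp2 q) ->
    (h (clamp2 q) * (lam i (clamp2 q))^-1 = h (clamp2 p) * (lam i (clamp2
      p))^-1)%g.
  exact: (@clamp2_continuous p _ (fh _ (clamp2_rect p) _ Ui)).
by apply: filterS nf => q; apply; exact: clamp2_rect.
Qed.
End ClampedSquare.

Section AngleLifting.
Context {R : realType}.
Local Notation C := R[i]^o.

Lemma continuous_small (S : topologicalType) (f : S -> R) s (e : R) : 0 < e ->
  {for s, continuous f} -> \forall t \near s, - e < f t - f s < e.
Proof.
move=> e0 cf; have /cvgrPdist_lt/(_ _ e0) := cf; apply: filterS => t.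
by rewrite distrC ltr_norml.
Qed.

(** A continuous argument is a flat function for the group (R, +) with the branches [arg_in a] as
    chart functions. Flatness determines it up to an additive constant, which is adjusted by [k] at
    the origin. *)
Lemma angle_lift (z : R * R -> C) : continuous z -> (forall p, z p != 0) ->
  exists2 th : R * R -> R, continuous th &
    forall p, z (clamp2 p) = (normc (z (clamp2 p)))%:C * expi (th p).
Proof.
move=> cz z0.
pose U (a : R) : set (R * R) := [set p | 0 < complex.Re (z p * expi (- a))].
pose lam (a : R) (p : R * R) : Algebra.to_multiplicative R := arg_in a (z p).
have cRe a : continuous (fun p => complex.Re (z p * expi (- a))).
  apply: (continuous_compT (@Re_continuous R)).
  by refine (continuousMC (b := fun=> expi (- a)) cz _); exact: cst_continuous.
have oU a p : U a p -> \forall q \near p, U a q.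
  move=> Up; have nb : nbhs (complex.Re (z p * expi (- a))) [set x : R | 0 < x].
    by apply: open_nbhs_nbhs; split=> //; exact: open_gt.
  exact: (cRe a p _ nb).
have zE a p : U a p -> z p = (normc (z p))%:C * expi (arg_in a (z p)).
  exact: arg_inE.
have nz p : (normc (z p))%:C != 0 :> R[i].
  by apply/eqP => /(congr1 (@complex.Re R)) /= e; have := normc_gt0 (z0 p);
    rewrite e ltxx.
have expiE a b p : U a p -> U b p ->
    expi (arg_in a (z p)) = expi (arg_in b (z p)).
  by move=> /zE e1 /zE e2; apply: (mulfI (nz p)); rewrite -e1.
have tr a b p : U a p -> U b p ->
    \forall q \near p, (lam b q * (lam a q)^-1 = lam b p * (lam a p)^-1)%g.
  move=> Ua Ub; pose d q := arg_in b (z q) - arg_in a (z q).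
  have cd : {for p, continuous d}.
    by apply: cvgB; apply: arg_in_continuous.
  (* Two branches have the same [expi], so their difference can only change by multiples of 2 pi;
     near [p] it changes by less than pi. *)
  have := continuous_small (@pi_gt0 R) cd.
  apply: filterS3 (oU _ _ Ua) (oU _ _ Ub) => q Uaq Ubq /andP[dq1 dq2].
  suff : d q - d p = 0 by move/eqP; rewrite subr_eq0 => /eqP.
  apply: expi_eq1_small => //; first exact: ltW.
  by rewrite /d !expiB (expiE b a) // (expiE b a p) // !mulfV ?expi_neq0 //
    invr1.
have [h fh] := clamped_trivial (fun p => arg_in_cover (z0 p)) oU tr.
pose h' p : R := h p.
have hE a p : U a (clamp2 p) -> \forall q \near p,
    h' q = h' p + (arg_in a (z (clamp2 q)) - arg_in a (z (clamp2 p))).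
  move=> Ua; apply: filterS (fh _ _ Ua) => q e.
  have {}e : h' q - arg_in a (z (clamp2 q)) = h' p - arg_in a (z (clamp2 p)) :=
    e.
  by rewrite addrCA -e addrC subrK.
(* The error of [h'] as an argument, as a unit complex number. In a chart it is [expi] of [h'] minus
   the branch, hence locally constant, hence constant. *)
pose c p := expi (h' p) / (z (clamp2 p)) * (normc (z (clamp2 p)))%:C.
have cE a p : U a (clamp2 p) -> c p = expi (h' p - arg_in a (z (clamp2 p))).
  move=> Ua; rewrite /c {1}(zE _ _ Ua) expiB invfM.
  by rewrite mulrA mulrAC mulfVK.
have cc p q : c p = c q.
  apply: (@locally_constant_connected _ _ setT) => // [|{}p _].
    exact: plane_connected.
  have [a Ua] := arg_in_cover (z0 (clamp2 p)).
  have Ua' : \forall q \near p, U a (clamp2 q).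
    exact: (@clamp2_continuous R p _ (oU _ _ Ua)).
  apply: filterS2 (hE _ _ Ua) Ua' => {}q hq Uq _.
  rewrite (cE a) // (cE a p) // hq; congr expi; ring.
have [a Ua] := arg_in_cover (z0 (clamp2 (0, 0))).
pose k := arg_in a (z (clamp2 (0, 0))) - h' (0, 0).
exists (fun p => h' p + k) => [p|p].
  have [b Ub] := arg_in_cover (z0 (clamp2 p)).
  rewrite /continuous_at.
  apply: cvgD; last exact: cvg_cst.
  pose w := z \o clamp2.
  have cw : continuous w by exact: (continuous_compT cz clamp2_continuous).
  have ca : {for p, continuous (fun q => arg_in b (w q))}
    by exact: arg_in_continuous.
  have : {for p, continuous (fun q => h' p + (arg_in b (w q) - arg_in b (w
    p)))}.
    apply: cvgD; first exact: cvg_cst.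
    by apply: cvgB; [exact: ca | exact: cvg_cst].
  rewrite /prop_for /continuous_at subrr addr0.
  apply: cvg_trans; apply: near_eq_cvg.
  by apply: filterS (hE _ _ Ub) => q ->.
have c1 : c p * expi k = 1.
  by rewrite (cc _ (0, 0)) (cE a) // -expiD /k addrC addrA subrK subrr expi0.
have e0 : z (clamp2 p) * c p = (normc (z (clamp2 p)))%:C * expi (h' p).
  by rewrite /c mulrA [_ * (_ / _)]mulrC divfK ?z0 // mulrC.
by rewrite expiD mulrA -e0 -mulrA c1 mulr1.
Qed.

End AngleLifting.

(** * The free monodromy of the twice punctured plane *)

Section Sheets.
Context {R : realType}.
Local Notation C := R[i]^o.

Definition side (c : bool) : R := if c then -1 else 1.

Lemma side_negb c : side (~~ c) = - side c.
Proof. by case: c; rewrite /= ?opprK. Qed.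

(* The plane punctured at 1 and -1 is cut along the real half-lines from
   1 to +oo and from -1 to -oo; the chart [None] is the cut plane and [Some c]
   is a half-plane around the cut of [c], crossed with monodromy [fg_gen c]. *)
Definition chart (i : option bool) (v : C) : Prop :=
  if i is Some c then 1 < side c * complex.Re v
  else complex.Im v != 0 \/ `|complex.Re v| < 1.

(** The jump of this function on the chart [Some c] is the crossing of the cut. Both signs are
    measured through [side c], which makes the rule compatible with [v -> - v] and the exchange of
    [c] and [~~ c]. *)
Definition potential (i : option bool) (v : C) : F2 :=
  if i is Some c then
    if 0 <= side c * complex.Im v then fg_gen c else 1%g
  else 1%g.

Lemma chart_cover v : v ^+ 2 != 1 -> exists i, chart i v.
Proof.
move=> v2; have [c1|c1] := ltP 1 (complex.Re v).
  by exists (Some false); rewrite /= mul1r.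
have [c2|c2] := ltP (complex.Re v) (-1).
  by exists (Some true); rewrite /= mulN1r; lra.
exists None; have [v0|] := eqVneq (complex.Im v) 0; last by left.
right; rewrite lt_neqAle ler_norml c1 c2 !andbT.
apply: contra v2 => /eqP n1; case: v v0 n1 {c1 c2} => x y /= -> n1.
have : x ^+ 2 = 1 by rewrite -real_normK ?num_real // n1 expr1n.
by move=> x1; rewrite expr2; simpc; rewrite -expr2 x1.
Qed.

Section Adapted.
Context {S : topologicalType}.
Implicit Types (v : S -> C) (h : S -> F2).

Lemma continuous_nbhs (a : S -> R) s (A : set R) : continuous a -> open A ->
  A (a s) ->
  \forall t \near s, A (a t).
Proof.
move=> ca oA As; have nA : nbhs (a s) A by apply: open_nbhs_nbhs.
exact: (ca s _ nA).
Qed.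

Lemma continuous_gt0 (a : S -> R) s : continuous a -> 0 < a s ->
  \forall t \near s, 0 < a t.
Proof. by move=> ca; apply: (@continuous_nbhs a s [set x | 0 < x]) => //;
  exact: open_gt. Qed.

Let cRe v : continuous v -> continuous (fun s => complex.Re (v s)).
Proof. exact: continuous_compT (@Re_continuous R). Qed.

Let cIm v : continuous v -> continuous (fun s => complex.Im (v s)).
Proof. exact: continuous_compT (@Im_continuous R). Qed.

Lemma chart_near v i s : continuous v -> chart i (v s) ->
  \forall t \near s, chart i (v t).
Proof.
move=> /[dup] /cRe cr /cIm ci; case: i => [c|] /=.
  rewrite -subr_gt0 => c0.
  have := @continuous_gt0 (fun t => side c * complex.Re (v t) - 1) s.
  have cc : continuous (fun t => side c * complex.Re (v t) - 1)
    by real_continuous.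
  by move=> /(_ cc c0); apply: filterS => t; rewrite subr_gt0.
case=> [i0|r1].
  have : 0 < complex.Im (v s) * complex.Im (v s) by rewrite -expr2
    exprn_even_gt0.
  have cc : continuous (fun t => complex.Im (v t) * complex.Im (v t))
    by real_continuous.
  move/(continuous_gt0 cc); apply: filterS => t /=;
    rewrite -expr2 exprn_even_gt0 //=.
  by left.
have cc : continuous (fun t => 1 - complex.Re (v t) * complex.Re (v t))
  by real_continuous.
have sq (x : R) : (0 < 1 - x * x) = (`|x| < 1).
  by rewrite subr_gt0 -expr2 -real_normK ?num_real // expr_lt1.
move: r1; rewrite -sq; move/(continuous_gt0 cc); apply: filterS => t.
by rewrite sq; right.
Qed.

(* On the overlap of two distinct charts the imaginary part does not vanish. *)
Lemma potential_near v i j s : continuous v -> chart i (v s) -> chart j (v s) ->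
  \forall t \near s, (potential j (v t) * (potential i (v t))^-1 =
                      potential j (v s) * (potential i (v s))^-1)%g.
Proof.
move=> cv ci cj; have [->|ij] := eqVneq i j.
  by near=> t; rewrite !mulgV.
have [/eqP i0|i0] := boolP (complex.Im (v s) == 0).
  exfalso; case: i j ci cj ij => [[]|] [[]|] //=;
    rewrite ?mul1r ?mulN1r ?i0 ?eqxx;
    try (by move=> *; lra); move=> H1 H2 _;
    have := ler_norm (complex.Re (v s)); have := ler_norm (- complex.Re (v s));
    rewrite normrN => *; by [case: H1 => // *; lra | case: H2 => // *; lra].
have cI := cIm cv.
have sgn : \forall t \near s, forall c, (0 <= side c * complex.Im (v t)) =
    (0 <= side c * complex.Im (v s)).
  have : 0 < complex.Im (v s) * complex.Im (v s) by rewrite -expr2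
    exprn_even_gt0.
  have cc : continuous (fun t => complex.Im (v s) * complex.Im (v t))
    by real_continuous.
  move/(continuous_gt0 cc); apply: filterS => t st c.
  have [i1|i1] := ltP 0 (complex.Im (v s)); case: c => /=;
    rewrite ?mul1r ?mulN1r; apply/idP/idP; nra.
apply: filterS sgn => t st; rewrite /potential.
by case: (i) => [c|]; case: (j) => [c'|]; rewrite ?st.
Unshelve. all: by end_near.
Qed.

(** The sheet of a lift of [v] to the universal cover of the twice punctured plane: [h] jumps
    exactly with the potential of each chart that contains the point. *)
Definition adapted v h := forall s i, chart i (v s) ->
  \forall t \near s, (h t * (potential i (v t))^-1 = h s * (potential i (v
    s))^-1)%g.

(** One chart at each point is enough, because potentials of overlapping charts have a locally
    constant quotient. *)
Lemma adapted_intro v h : continuous v ->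
  (forall s, exists2 i, chart i (v s) & \forall t \near s,
    (h t * (potential i (v t))^-1 = h s * (potential i (v s))^-1)%g) ->
  adapted v h.
Proof.
move=> cv hP s j cj; have [i ci hi] := hP s.
apply: filterS2 hi (potential_near cv cj ci) => t ht pt.
have E u : (h u * (potential j (v u))^-1 = h u * (potential i (v u))^-1 *
    (potential i (v u) * (potential j (v u))^-1))%g by rewrite mulgA mulgVK.
by rewrite E (E s) ht pt.
Qed.

Lemma adapted_mul v h g : adapted v h -> adapted v (fun s => g * h s)%g.
Proof.
by move=> ah s i ci; apply: filterS (ah s i ci) => t ht; rewrite -!mulgA ht.
Qed.

(** Negation carries the chart of [c] to that of [~~ c] and the potential to its image under
    [swap]. *)
Lemma adapted_opp v h : adapted v h -> adapted (fun s => - v s) (swap \o h).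
Proof.
have chartN i z : chart i (- z) -> chart (omap negb i) z.
  case: i => [c|] /=; rewrite !raddfN /= ?oppr_eq0 ?normrN //.
  by rewrite side_negb mulNr mulrN.
have potN i z : potential i (- z) = swap (potential (omap negb i) z).
  case: i => [c|]; last by rewrite /= ?aut1.
  rewrite /potential [omap _ _]/= raddfN mulrN side_negb mulNr.
  case: ifP => _; last by rewrite aut1.
  by rewrite swap_gen negbK.
have swapV g : (swap g)^-1%g = swap g^-1%g.
  by apply: (mulgI (swap g)); rewrite mulgV -autM mulgV aut1.
move=> ah s i /chartN ci; apply: filterS (ah s _ ci) => t ht.
by rewrite !potN !swapV -!autM ht.
Qed.

Lemma adapted_unique v h h' : connected [set: S] -> continuous v ->
  (forall s, v s ^+ 2 != 1) -> adapted v h -> adapted v h' ->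
  forall s t, (h s * (h' s)^-1 = h t * (h' t)^-1)%g.
Proof.
move=> cS cv v1 ah ah' s t.
have fl (k : S -> F2) : adapted v k ->
    flat_on (fun i s => chart i (v s)) (fun i s => potential i (v s)) setT k.
  by move=> ak p _ i ci; apply: filterS (ak p i ci) => q kq _.
by apply: (flat_on_unique (fun s => chart_cover (v1 s)) cS (fl h ah) (fl h'
  ah')).
Qed.

Lemma adapted_paste (k : S -> R) v h v' h' : continuous k -> adapted v h ->
  adapted v' h' -> (forall s, k s = 0 -> v s = v' s /\ h s = h' s) ->
  adapted (fun s => if k s <= 0 then v s else v' s)
    (fun s => if k s <= 0 then h s else h' s).
Proof.
move=> ck ah ah' e s i /=; have [k0|k0|k0] := ltgtP (k s) 0.
- move=> ci; have kn : \forall t \near s, 0 < - k t.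
    by apply: continuous_gt0; [real_continuous|rewrite oppr_gt0].
  apply: filterS2 kn (ah s i ci) => t; rewrite oppr_gt0 => kt ht.
  by rewrite ltW.
- move=> ci; apply: filterS2 (continuous_gt0 ck k0) (ah' s i ci) => t kt ht.
  by rewrite leNgt kt.
have [vE hE] := e s k0; move=> ci; have ci' : chart i (v' s) by rewrite -vE.
apply: filterS2 (ah s i ci) (ah' s i ci') => t ht ht'.
by case: ifP => _ //; rewrite ht' -hE -vE.
Qed.

End Adapted.

Lemma adapted_comp (S S' : topologicalType) (v : S -> C) h (k : S' -> S) :
  continuous k -> adapted v h -> adapted (v \o k) (h \o k).
Proof.
by move=> ck ah s i ci; apply: (ck s _ (ah (k s) i ci)).
Qed.

Lemma adapted_lift (z : R * R -> C) : continuous z -> (forall p,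
  z p ^+ 2 != 1) ->
  exists h, adapted (z \o clamp2) h.
Proof.
move=> cz z1.
have [h fh] := clamped_trivial (fun p => chart_cover (z1 p))
  (fun i p => @chart_near _ z i p cz) (fun i j p =>
    @potential_near _ z i j p cz).
by exists h => s i ci; exact: fh.
Qed.

End Sheets.

(** * Polar coordinates and lifts *)

Lemma continuous_realC (R : realType) (S : topologicalType) (a : S -> R) :
  continuous a -> continuous (fun s => (a s)%:C : R[i]^o).
Proof. by move=> ca; refine (Complex_continuous ca _);
  exact: cst_continuous. Qed.

Lemma continuous_sqrtR (R : realType) (S : topologicalType) (a : S -> R) :
  continuous a -> continuous (fun s => Num.sqrt (a s)).
Proof. exact: continuous_compT (@sqrt_continuous R). Qed.

Section ComplexFunctions.
Context {R : realType} {S : topologicalType}.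
Implicit Types (a : S -> R[i]^o) (t : S -> R).

Lemma continuous_expi t : continuous t -> continuous (fun s =>
  expi (t s) : R[i]^o).
Proof. exact: continuous_compT (@expi_continuous R). Qed.

Lemma continuous_normc a : continuous a -> continuous (fun s => normc (a s)).
Proof. exact: continuous_compT (@normc_continuous R). Qed.

Lemma continuous_Re a : continuous a -> continuous (fun s => complex.Re (a s)).
Proof. exact: continuous_compT (@Re_continuous R). Qed.

Lemma continuous_Im a : continuous a -> continuous (fun s => complex.Im (a s)).
Proof. exact: continuous_compT (@Im_continuous R). Qed.
End ComplexFunctions.

(** Sums, opposites and products look alike over R and over C; the value type of the function
    decides which continuity lemma applies. *)
Ltac complex_valued f :=
  lazymatch type of f with _ -> ?T =>
    let T' := eval hnf in T in lazymatch T' with complex _ => idtac end end.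

Ltac complex_continuous_at f :=
  lazymatch f with
  | (fun s => (@?a s + @?b s)%R) => tryif complex_valued f then refine (continuousDC (a := a) (b := b) _ _) else refine (continuousDR (a := a) (b := b) _ _)
  | (fun s => (- @?a s)%R) => tryif complex_valued f then refine (continuousNC (a := a) _) else refine (continuousNR (a := a) _)
  | (fun s => (@?a s * @?b s)%R) => tryif complex_valued f then refine (continuousMC (a := a) (b := b) _ _) else refine (continuousMR (a := a) (b := b) _ _)
  | (fun s => (@?a s)%:C) => refine (continuous_realC (a := a) _)
  | (fun s => expi (@?a s)) => refine (continuous_expi (t := a) _)
  | (fun s => normc (@?a s)) => refine (continuous_normc (a := a) _)
  | (fun s => Num.sqrt (@?a s)) => refine (continuous_sqrtR (a := a) _)
  | (fun s => complex.Re (@?a s)) => refine (continuous_Re (a := a) _)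
  | (fun s => complex.Im (@?a s)) => refine (continuous_Im (a := a) _)
  | _ => real_continuous_at f
  end.
Ltac complex_continuous_step :=
  first [ continuous_hyp | lazymatch goal with |- forall x, continuous_at x ?f =>
    let f' := eval cbv beta in f in complex_continuous_at f' end
  | assumption ].
Ltac complex_continuous := solve [repeat complex_continuous_step].

Section Locus.
Context {R : realType}.
Local Notation C := R[i]^o.
Local Notation X := (kepler_regular_locus R).
Implicit Types (p : X) (v : R[i]) (t r : R).

Lemma locus_base_subproof : ((0, 1) : C2 R) \in ~` @kepler_discriminant R.
Proof.
rewrite inE /kepler_discriminant /= expr0n mulr0 mul0r addr0 mulr1.
by apply/eqP; rewrite oner_eq0.
Qed.

Definition locus_base : X :=
  @exist (C2 R) (fun z => z \in ~` @kepler_discriminant R) (0,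
    1) locus_base_subproof.

(* The junk value for points of the discriminant is the base point. *)
Definition to_locus (z : C2 R) : X := insubd locus_base z.

Lemma to_locusE (z : C2 R) : z.2 != 0 -> 1 + 2 * z.1 ^+ 2 * z.2 != 0 ->
  val (to_locus z) = z.
Proof.
move=> z1 z2; apply: insubdK; rewrite inE /kepler_discriminant /=.
by apply/eqP; rewrite mulf_eq0 negb_or z1 z2.
Qed.

Lemma to_locusK p : to_locus (val p) = p. Proof. exact: valKd. Qed.

Lemma to_locus_continuous (S : topologicalType) (a b : S -> C) :
  continuous a -> continuous b -> (forall s, b s != 0) ->
  (forall s, 1 + 2 * a s ^+ 2 * b s != 0) ->
  continuous (fun s => to_locus (a s, b s)).
Proof.
move=> ca cb b0 ab; apply: continuous_comp_initial.
have -> : set_val \o (fun s => to_locus (a s, b s)) = fun s => (a s,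
  b s) : C2 R.
  by apply/funext => s; exact: (@to_locusE (a s, b s) (b0 s) (ab s)).
exact: (continuous_pair ca cb).
Qed.

Definition xco p : R[i] := (val p).1.
Definition yco p : R[i] := (val p).2.

Lemma val_locus_continuous : continuous (val : X -> C2 R).
Proof. exact: initial_continuous. Qed.

Lemma xco_continuous : continuous (xco : X -> C).
Proof. exact: (continuous_compT continuous_fstT val_locus_continuous). Qed.

Lemma yco_continuous : continuous (yco : X -> C).
Proof. exact: (continuous_compT continuous_sndT val_locus_continuous). Qed.

Lemma locusP p : yco p != 0 /\ 1 + 2 * xco p ^+ 2 * yco p != 0.
Proof.
have := valP p; rewrite inE /kepler_discriminant /= => /eqP.
by rewrite mulf_eq0 negb_or => /andP[].
Qed.

Lemma normc_yco_gt0 p : 0 < normc (yco p).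
Proof. by apply: normc_gt0; have [] := locusP p. Qed.

Definition kappa : R[i] := sqrtc (-2).

Lemma kappa_sqr : kappa ^+ 2 = -2. Proof. exact: sqr_sqrtc. Qed.

Lemma kappa_neq0 : kappa != 0.
Proof.
have : kappa ^+ 2 != 0 by rewrite kappa_sqr oppr_eq0 pnatr_eq0.
by rewrite expf_eq0.
Qed.

Lemma sqrtC_sqr r : 0 <= r -> (Num.sqrt r)%:C ^+ 2 = r%:C.
Proof. by move=> r0; rewrite -rmorphXn /= sqr_sqrtr. Qed.

Lemma expi_half t : expi (t / 2) ^+ 2 = expi t.
Proof. by rewrite expr2 -expiD -splitr. Qed.

(* With y = r e^(it), the coordinate v = kappa x sqrt(r) e^(it/2) satisfies
   v^2 = - 2 x^2 y, so that the locus becomes v^2 <> 1. *)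
Definition vco p t : R[i] :=
  kappa * xco p * (Num.sqrt (normc (yco p)))%:C * expi (t / 2).

Lemma vco_sqr p t : yco p = (normc (yco p))%:C * expi t ->
  vco p t ^+ 2 = - (2 * xco p ^+ 2 * yco p).
Proof.
move=> yE; rewrite /vco !exprMn kappa_sqr sqrtC_sqr ?normc_ge0 ?expi_half;
  last first.
  by rewrite ltW // normc_yco_gt0.
by rewrite -mulrA -yE !mulNr.
Qed.

Lemma vco_neq1 p t : yco p = (normc (yco p))%:C * expi t -> vco p t ^+ 2 != 1.
Proof.
move=> /vco_sqr ->; have [_] := locusP p; apply: contra => /eqP e.
by rewrite -[X in X + _]e addNr.
Qed.

Definition polar v t r : X :=
  to_locus (kappa^-1 * v * ((Num.sqrt r)^-1)%:C * expi (- (t / 2)),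
    r%:C * expi t).

Lemma polar_valid v t r : v ^+ 2 != 1 -> 0 < r ->
  (r%:C * expi t != 0) /\ (1 + 2 * (kappa^-1 * v * ((Num.sqrt r)^-1)%:C * expi
    (- (t / 2))) ^+ 2 * (r%:C * expi t) != 0).
Proof.
move=> v1 r0; have rC : r%:C != 0 :> R[i].
  by apply/eqP => /(congr1 (@complex.Re R)) /= e; rewrite e ltxx in r0.
split; first by rewrite mulf_neq0 ?expi_neq0.
apply: contra v1 => /eqP e; apply/eqP.
have sE : ((Num.sqrt r)^-1)%:C ^+ 2 * r%:C = 1 :> R[i].
  by rewrite -rmorphXn -rmorphM /= exprVn sqr_sqrtr ?ltW // mulVf ?gt_eqF.
have eE : expi (- (t / 2)) ^+ 2 * expi t = 1.
  by rewrite expiN exprVn expi_half mulVf ?expi_neq0.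
have kE : kappa^-1 ^+ 2 = - 2^-1 by rewrite exprVn kappa_sqr invrN.
have : 1 - v ^+ 2 = 0.
  rewrite -e !exprMn kE; set s := _%:C ^+ 2 in sE *; set w :=
    expi _ ^+ 2 in eE *.
  rewrite (_ : 2 * _ * _ = - v ^+ 2 * (s * r%:C) * (w * expi t)).
    by rewrite sE eE !mulr1.
  by field.
by move/eqP; rewrite subr_eq0 => /eqP.
Qed.

Lemma polarE v t r : v ^+ 2 != 1 -> 0 < r ->
  val (polar v t r) = (kappa^-1 * v * ((Num.sqrt r)^-1)%:C * expi (- (t / 2)),
    r%:C * expi t).
Proof. by move=> v1 r0; have [? ?] := polar_valid t v1 r0;
  apply: to_locusE. Qed.

Lemma yco_polar v t r : v ^+ 2 != 1 -> 0 < r ->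
  yco (polar v t r) = r%:C * expi t.
Proof. by move=> v1 r0; rewrite /yco polarE. Qed.

Lemma normc_yco_polar v t r : v ^+ 2 != 1 -> 0 < r ->
  normc (yco (polar v t r)) = r.
Proof. by move=> v1 r0; rewrite yco_polar // normcM normc_expi mulr1 normc_real
  ?ltW. Qed.

Lemma vco_polar v t r : v ^+ 2 != 1 -> 0 < r -> vco (polar v t r) t = v.
Proof.
move=> v1 r0; rewrite /vco normc_yco_polar // /xco polarE //= expiN.
have sr : Num.sqrt r != 0 by rewrite gt_eqF // sqrtr_gt0.
have sC : (Num.sqrt r)%:C != 0 :> R[i].
  by apply: contra sr => /eqP /(congr1 (@complex.Re R)) /= ->.
have -> : ((Num.sqrt r)^-1)%:C = ((Num.sqrt r)%:C)^-1 :> R[i]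
  by rewrite fmorphV.
by field; rewrite kappa_neq0 sC expi_neq0.
Qed.

Lemma polar_vco p t : yco p = (normc (yco p))%:C * expi t ->
  polar (vco p t) t (normc (yco p)) = p.
Proof.
move=> yE; apply: val_inj; rewrite polarE ?vco_neq1 ?normc_yco_gt0 //.
rewrite -yE [RHS]surjective_pairing; congr pair.
rewrite /vco expiN -/(xco p); have r0 := normc_yco_gt0 p.
have sr : Num.sqrt (normc (yco p)) != 0 by rewrite gt_eqF // sqrtr_gt0.
have sC : (Num.sqrt (normc (yco p)))%:C != 0 :> R[i].
  by apply: contra sr => /eqP /(congr1 (@complex.Re R)) /= ->.
rewrite fmorphV; field; rewrite kappa_neq0 sC expi_neq0 //.
Qed.

Lemma polar_base : polar 0 0 1 = locus_base.
Proof.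
apply: val_inj; rewrite polarE ?expr0n ?(eq_sym 0) ?oner_eq0 ?ltr01 //.
by rewrite mulr0 !mul0r expi0 mulr1.
Qed.

Lemma polar_continuous (S : topologicalType) (v : S -> C) (t r : S -> R) :
  continuous v -> continuous t -> continuous r ->
  (forall s, v s ^+ 2 != 1) -> (forall s, 0 < r s) ->
  continuous (fun s => polar (v s) (t s) (r s)).
Proof.
move=> cv ct cr v1 r0.
pose q s := (Num.sqrt (r s))^-1.
have cq : continuous q.
  move=> s; apply: cvgV; first by rewrite gt_eqF // sqrtr_gt0.
  exact: (continuous_sqrtR cr).
pose a s : C := kappa^-1 * v s * (q s)%:C * expi (- (t s / 2)).
pose b s : C := (r s)%:C * expi (t s).
have ca : continuous a by rewrite /a; complex_continuous.
have cb : continuous b by rewrite /b; complex_continuous.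
refine (to_locus_continuous (a := a) (b := b) ca cb _ _) => s.
- by have [] := polar_valid (t s) (v1 s) (r0 s).
- by have [] := polar_valid (t s) (v1 s) (r0 s).
Qed.

Lemma vco_continuous (S : topologicalType) (F : S -> X) (t : S -> R) :
  continuous F -> continuous t -> continuous (fun s => vco (F s) (t s) : C).
Proof.
move=> cF ct; have cx := continuous_compT xco_continuous cF.
have cy := continuous_compT yco_continuous cF.
by rewrite /vco; complex_continuous.
Qed.

End Locus.

Section Lifts.
Context {R : realType}.
Local Notation C := R[i]^o.
Local Notation X := (kepler_regular_locus R).

Section Domain.
Context {S : topologicalType}.
Implicit Types (F : S -> X) (t : S -> R) (h : S -> F2).

(* A lift of F to the universal cover: a continuous argument t of the coordinate
   y, and the sheet h of the coordinate v over the twice punctured plane. *)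
Definition polar_lift F t h := [/\ continuous t,
  forall s, yco (F s) = (normc (yco (F s)))%:C * expi (t s) &
  adapted (fun s => vco (F s) (t s) : C) h].

(** The difference of the arguments is continuous with values in the multiples of 2 pi, hence
    constant. With equal arguments both sheets are adapted to the same [v], and their quotient is
    constant. *)
Lemma lift_unique F t t' h h' s0 : connected [set: S] -> continuous F ->
  polar_lift F t h -> polar_lift F t' h' -> t s0 = t' s0 -> h s0 = h' s0 ->
  forall s, t s = t' s /\ h s = h' s.
Proof.
move=> cS cF [ct tE ah] [ct' tE' ah'] e0 f0.
have expE s : expi (t s) = expi (t' s).
  have n0 : (normc (yco (F s)))%:C != 0 :> R[i].
    have := normc_yco_gt0 (F s); apply: contraTN =>
      /eqP/(congr1 (@complex.Re R)) /= ->.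
    by rewrite ltxx.
  by apply: (mulfI n0); rewrite -tE -tE'.
have tt s : t s = t' s.
  pose d u := t u - t' u.
  suff : d s = d s0 by rewrite /d e0 subrr => /eqP; rewrite subr_eq0 => /eqP.
  apply: (@locally_constant_connected _ _ setT) => // u _.
  have cd : continuous d by rewrite /d; real_continuous.
  apply: filterS (continuous_small (@pi_gt0 R) (cd u)) => w /andP[w1 w2] _.
  suff : d w - d u = 0 by move/eqP; rewrite subr_eq0 => /eqP.
  apply: expi_eq1_small => //; first exact: ltW.
  by rewrite /d !expiB !expE !mulfV ?expi_neq0 // invr1.
move=> s; split=> //; have tt' : t' = t by apply/funext => u.
rewrite {}tt' in ah' *.
have cv : continuous (fun s => vco (F s) (t s) : C) by exact: vco_continuous.
have := adapted_unique cS cv (fun u => vco_neq1 (tE u)) ah ah' s s0.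
by rewrite f0 mulgV => /eqP; rewrite -(inj_eq (@mulIg _ (h' s))) mulgVK mul1g =>
  /eqP.
Qed.

Lemma lift_paste (k : S -> R) F F' t t' h h' : continuous k ->
  polar_lift F t h ->
  polar_lift F' t' h' ->
  (forall s, k s = 0 -> [/\ F s = F' s, t s = t' s & h s = h' s]) ->
  polar_lift (fun s => if k s <= 0 then F s else F' s)
    (fun s => if k s <= 0 then t s else t' s)
    (fun s => if k s <= 0 then h s else h' s).
Proof.
move=> ck [ct tE ah] [ct' tE' ah'] e; split.
- by apply: (paste_continuous ck) => // s /e[].
- by move=> s; case: ifP.
have := adapted_paste ck ah ah'; rewrite (_ : (fun s =>
  if k s <= 0 then vco _ _ else _) =
    (fun s => vco (if k s <= 0 then F s else F' s) (if k s <= 0 then t s else t'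
      s))).
  by apply=> s /e[-> -> ->].
by apply/funext => s; case: ifP.
Qed.

Lemma vco_shift p (a : R) (n : int) :
  vco p (a + n%:~R * (2 * pi)) = expi (n%:~R * pi) * vco p a.
Proof.
have e : (a + n%:~R * (2 * pi)) / 2 = a / 2 + n%:~R * pi by field.
by rewrite /vco e expiD mulrA [RHS]mulrC.
Qed.

Lemma zpow_pred (G : groupType) (g : G) (n : int) : zpow g (n - 1)%R = (zpow g n
  * g^-1)%g.
Proof. by rewrite -{2}(subrK 1 n) zpowS mulgK. Qed.

Lemma adapted_zpow_swap (v : S -> C) h (n : int) : adapted v h ->
  adapted (fun s => expi (n%:~R * pi) * v s : C) (zpow swap n \o h).
Proof.
elim/int_rect: n v h => [|n IHn|n IHn] v h ah.
- rewrite mul0r expi0 (_ : (fun s => 1 * v s) = v) //.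
  by apply/funext => s; rewrite mul1r.
- have -> : n.+1%:Z = n%:Z + 1 by lia.
  have := IHn _ _ (adapted_opp ah).
  rewrite (_ : (fun s => expi (n%:Z%:~R * pi) * - v s) =
    (fun s => expi ((n%:Z + 1)%:~R * pi) * v s)).
    by rewrite (_ : _ \o (swap \o h) = zpow swap (n%:Z + 1) \o h) // zpowS.
  by apply/funext => s; rewrite intrD mulrDl mul1r expiD expi_pi mulrN1 mulrN
    mulNr.
- have -> : - n.+1%:Z = - n%:Z - 1 by lia.
  have := IHn _ _ (adapted_opp ah).
  rewrite (_ : (fun s => expi ((- n%:Z)%:~R * pi) * - v s) =
    (fun s => expi ((- n%:Z - 1)%:~R * pi) * v s)).
    (* [swap] is its own inverse as a function, so [adapted_opp] also serves for a turn in the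
       negative direction. *)
    by rewrite (_ : _ \o (swap \o h) = zpow swap (- n%:Z - 1) \o h) //
      zpow_pred.
  apply/funext => s; rewrite intrB mulrBl mul1r expiB expi_pi invrN1 mulrN1.
  by rewrite mulrN mulNr.
Qed.

(** The deck transformation of [(g, n)]. Turning y [n] times multiplies v by (-1)^n, so the sheet is
    twisted by [swap] before the left multiplication; this is the product of the semidirect
    product. *)
Lemma lift_deck F t h (g : F2) (n : int) : polar_lift F t h ->
  polar_lift F (fun s => t s + n%:~R * (2 * pi)) (fun s =>
    g * zpow swap n (h s))%g.
Proof.
case=> ct tE ah; split.
- by real_continuous.
- by move=> s; rewrite expiD expi_2pi_int mulr1.
apply: adapted_mul; have := adapted_zpow_swap (n := n) ah.
rewrite (_ : (fun s => expi _ * _) = (fun s =>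
  vco (F s) (t s + n%:~R * (2 * pi)))) //.
by apply/funext => s; rewrite vco_shift.
Qed.

End Domain.

Lemma lift_comp (S S' : topologicalType) (F : S -> X) t h (k : S' -> S) :
  continuous k -> polar_lift F t h -> polar_lift (F \o k) (t \o k) (h \o k).
Proof.
move=> ck [ct tE ah]; split; [by real_continuous|by move=> s; exact: tE|].
exact: (adapted_comp ck ah).
Qed.

Lemma clamp2K (p : R * R) : clamp2 (clamp2 p) = clamp2 p.
Proof. by congr pair; apply: clampR_id; exact: clampR01. Qed.

Lemma lift_square (H : R * R -> X) : continuous H ->
  exists t h, polar_lift (H \o clamp2) t h.
Proof.
move=> cH; have cc := @clamp2_continuous R.
have cHc : continuous (H \o clamp2) by real_continuous.
have cy := continuous_compT (@yco_continuous R) cH.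
have [th cth thE] := angle_lift cy (fun p => (locusP (H p)).1).
(* With the argument factoring through [clamp2], the whole v-coordinate does too, and [adapted_lift]
   gives a sheet for it rather than for its composite with [clamp2]. *)
pose t := th \o clamp2.
have ct : continuous t by rewrite /t; real_continuous.
have tE p : yco (H (clamp2 p)) = (normc (yco (H (clamp2 p))))%:C * expi (t p).
  by have := thE (clamp2 p); rewrite clamp2K.
have cv := vco_continuous cHc ct.
have [h ah] := adapted_lift cv (fun p => vco_neq1 (tE p)).
exists t, h; split=> //.
suff e : (fun p => vco ((H \o clamp2) p) (t p)) \o clamp2 =
  (fun p => vco ((H \o clamp2) p) (t p)) by rewrite -e.
by apply/funext => p; rewrite /t /= !clamp2K.
Qed.

(** * Monodromy of a loop: existence, homotopy invariance, products *)

Section Monodromy.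
Local Notation x0 := (@locus_base R).
Local Notation G := (semidirect (zpow swap)).
Implicit Types f : {path unitI R from x0 to x0 in X}.

Definition monodromy f (g : G) := exists t h, [/\ polar_lift (loop_line f) t h,
  t 0 = 0, h 0 = 1%g, t 1 = (g.2 : int)%:~R * (2 * pi) & h 1 = g.1].

Lemma yco_base : yco x0 = 1. Proof. by []. Qed.

Lemma vco_base t : vco x0 t = 0.
Proof. by rewrite /vco /xco /= mulr0 !mul0r. Qed.

Lemma chart_base : chart None (0 : C).
Proof. by right; rewrite normr0 ltr01. Qed.

Lemma normc_base : (normc (yco x0))%:C = 1 :> R[i].
Proof. by rewrite yco_base normc1. Qed.

Lemma lift_base (S : topologicalType) (F : S -> X) t h s : polar_lift F t h ->
  F s = x0 ->
  exists n : int, t s = n%:~R * (2 * pi).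
Proof.
case=> _ tE _ Fs; apply: expi_eq1; have := tE s.
by rewrite Fs normc_base mul1r yco_base.
Qed.

Lemma int_2pi_inj (m n : int) : m%:~R * (2 * pi) = n%:~R * (2 * pi) :> R ->
  m = n.
Proof.
have p0 : 2 * pi != 0 :> R by rewrite mulf_neq0 // gt_eqF // pi_gt0.
by move/(mulIf p0)/eqP; rewrite eqr_int => /eqP.
Qed.

Lemma lift_cst (S : topologicalType) (t0 : R) (g : F2) : expi t0 = 1 ->
  polar_lift (fun _ : S => x0) (fun=> t0) (fun=> g).
Proof.
move=> e0; split.
- exact: cst_continuous.
- by move=> s; rewrite normc_base e0 mulr1.
by move=> s i ci; near=> u.
Unshelve. all: by end_near.
Qed.

Lemma lift_normalize (S : topologicalType) (F : S ->
  X) t h s0 : polar_lift F t h ->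
  F s0 = x0 -> exists t' h', [/\ polar_lift F t' h', t' s0 = 0 & h' s0 = 1%g].
Proof.
move=> lF Fs; have [n tn] := lift_base lF Fs.
(* Undoing the [n] turns twists the sheet, so the left factor inverts the twisted value. *)
pose g := (zpow swap (- n)%R (h s0))^-1%g.
exists (fun s => t s + (- n)%:~R * (2 * pi)), (fun s =>
  g * zpow swap (- n)%R (h s))%g.
split; first exact: lift_deck.
  by rewrite tn intrN mulNr subrr.
by rewrite /g mulVg.
Qed.

(** The homotopy is lifted over the square. Its vertical edges are constant paths, whose lifts are
    constant by uniqueness; so the lifts of the bottom and top edges have the same ends, and
    uniqueness identifies them with the given lifts. *)
Lemma monodromy_homotopic f f' g g' : homotopic f f' ->
  monodromy f g -> monodromy f' g' -> g = g'.
Proof.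
move=> /homotopic_elim[H [cH H0 H1 H0s H1s]].
have cl (a : R) : loop_line f (clampR a) = loop_line f a by exact: loop_lineE
  (clamp a).
have cl' (a : R) : loop_line f' (clampR a) = loop_line f' a by exact: loop_lineE
  (clamp a).
have Hc p : (p.1 <= 0) || (1 <= p.1) -> (H \o clamp2) p = x0.
  case: p => a b /= /orP[a0|a1]; first by rewrite H0s ?clampR_le0.
  by rewrite H1s ?clampR_ge1.
have [t [h lH]] := lift_square cH.
have [{}t [{}h [{}lH t00 h00]]] : exists t' h',
    [/\ polar_lift (H \o clamp2) t' h', t' (0, 0) = 0 & h' (0, 0) = 1%g].
  by apply: (lift_normalize lH); rewrite Hc //= lexx.
have cHc : continuous (H \o clamp2).
  exact: (continuous_compT cH (@clamp2_continuous R)).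
have connR := @line_connected R.
have vert (a : R) : (a <= 0) || (1 <= a) -> t (a, 0) = t (a, 1) /\ h (a,
  0) = h (a, 1).
  move=> a01; have ca : continuous (fun s : R => (a, s)) by real_continuous.
  have la := lift_comp ca lH.
  have Fa : (H \o clamp2) \o pair a = fun=> x0.
    by apply/funext => s /=; exact: (Hc (a, s)).
  rewrite Fa in la; have [n tn] := lift_base (s := 0) la erefl.
  have lc : polar_lift (fun _ : R => x0) (fun=> t (a, 0)) (fun=> h (a, 0)).
    by apply: lift_cst; rewrite [t _]tn expi_2pi_int.
  by have [] := lift_unique connR (@cst_continuous _ _ _) lc la (s0 := 0) erefl
    erefl 1.
have hor (b : R) : continuous (fun s : R => (s, b)) by real_continuous.
have l0 := lift_comp (hor 0) lH; have l1 := lift_comp (hor 1) lH.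
have E0 : (H \o clamp2) \o (fun s : R => (s, 0)) = loop_line f.
  by apply/funext => s; rewrite /= H0 ?cl // clampR_le0.
have E1 : (H \o clamp2) \o (fun s : R => (s, 1)) = loop_line f'.
  by apply/funext => s; rewrite /= H1 ?cl' // clampR_ge1.
rewrite E0 in l0; rewrite E1 in l1.
have le00 : (0 <= 0 :> R) || (1 <= 0 :> R) by rewrite lexx.
have le11 : (1 <= 0 :> R) || (1 <= 1 :> R) by rewrite lexx orbT.
have [v0 w0] := vert 0 le00; have [v1 w1] := vert 1 le11.
case=> [ta [ha [la a1 a2 a3 a4]]] [tb [hb [lb b1 b2 b3 b4]]].
have [A1 A2] := lift_unique connR (@loop_line_continuous _ _ _ f) l0 la
  (etrans t00 (esym a1)) (etrans h00 (esym a2)) 1.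
have [B1 B2] := lift_unique connR (@loop_line_continuous _ _ _ f') l1 lb
  (s0 := 0) (etrans (etrans (esym v0) t00) (esym b1)) (etrans (etrans (esym w0)
    h00) (esym b2)) 1.
rewrite [g]surjective_pairing [g']surjective_pairing; congr pair.
  by rewrite -a4 -b4 -A2 -B2.
by apply: int_2pi_inj; rewrite -a3 -b3 -A1 -B1.
Qed.

Lemma monodromy_total f : exists g, monodromy f g.
Proof.
have cf := @loop_line_continuous _ _ _ f.
(* The loop is lifted as a homotopy independent of the second variable, and the lift is restricted
   to the bottom edge. *)
have cF : continuous (fun p : R * R => loop_line f p.1) by real_continuous.
have [t [h lF]] := lift_square cF.
have ch : continuous (fun s : R => (s, 0) : R * R) by real_continuous.
have {lF} := lift_comp ch lF.
have -> : ((fun p => loop_line f p.1) \o clamp2) \o (fun s : R => (s,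
  0)) = loop_line f.
  by apply/funext => s; exact: (loop_lineE f (clamp s)).
move=> lF; have f0 : loop_line f 0 = x0 by rewrite loop_line_le0.
have f1 : loop_line f 1 = x0 by rewrite loop_line_ge1.
have [t' [h' [lf' t'0 h'0]]] := lift_normalize lF f0.
have [n tn] := lift_base lf' f1.
by exists ((h' 1, n) : G), t', h'.
Qed.

(** The deck transformation of [g] moves the lift of the second loop so that it starts where the
    first lift ends; its end point is then the product. *)
Lemma monodromyM f f' g g' : monodromy f g -> monodromy f' g' ->
  monodromy (concat f f') (g * g')%g.
Proof.
case=> [t [h [lf t0 h0 t1 h1]]] [t' [h' [lf' t'0 h'0 t'1 h'1]]].
have cd : continuous (fun s : R => 2 * s) by real_continuous.
have ce : continuous (fun s : R => 2 * s - 1) by real_continuous.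
have l1 := lift_comp cd lf.
have l2 := lift_deck g.1 (g.2 : int) (lift_comp ce lf').
have := lift_paste ce l1 l2.
set Fp := (F in polar_lift F _ _).
have -> : Fp = loop_line (concat f f').
  by apply/funext => s; rewrite /Fp concat_line.
move=> lp; pose tp s := if 2 * s - 1 <= 0 then (t \o (fun s => 2 * s)) s
   else ((t' \o (fun s => 2 * s - 1)) s + (g.2 : int)%:~R * (2 * pi)).
pose hp s := if 2 * s - 1 <= 0 then (h \o (fun s => 2 * s)) s
   else (g.1 * zpow swap g.2 ((h' \o (fun s => 2 * s - 1)) s))%g.
exists tp, hp; split.
- apply: lp => s s0; have s1 : 2 * s = 1 by lra.
  rewrite /= s0 s1 t'0 h'0 t1 h1 loop_line_ge1 // loop_line_le0 //.
  by rewrite add0r aut1 mulg1.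
- by rewrite /tp ifT /= ?mulr0 //; lra.
- by rewrite /hp ifT /= ?mulr0 //; lra.
- have e1 : 2 * 1 - 1 = 1 :> R by lra.
  rewrite /tp ifF; last lra.
  have -> : ((g * g')%g.2 : int) = (g.2 : int) + (g'.2 : int) by [].
  by rewrite /= e1 t'1 -mulrDl -intrD addrC.
- have e1 : 2 * 1 - 1 = 1 :> R by lra.
  rewrite /hp ifF; last lra.
  by rewrite /= e1 h'1.
Qed.

End Monodromy.
End Lifts.

(** * Monodromy of the generators *)

Section Generators.
Context {R : realType}.
Local Notation C := R[i]^o.
Local Notation X := (kepler_regular_locus R).
Local Notation x0 := (@locus_base R).
Local Notation G := (semidirect (zpow swap)).

Definition fiber (v : R[i]) : X := polar v 0 1.

Lemma fiber0 : fiber 0 = x0. Proof. exact: polar_base. Qed.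

Lemma fiber_continuous (S : topologicalType) (v : S -> C) : continuous v ->
  (forall s, v s ^+ 2 != 1) -> continuous (fun s => fiber (v s)).
Proof.
move=> cv v1; have c0 := @cst_continuous S R 0; have c1 :=
  @cst_continuous S R 1.
by apply: (polar_continuous cv c0 c1 v1) => _; exact: ltr01.
Qed.

(** The unit circle around the puncture [side c], starting at 0 and crossing the cut of [c] at
    [2 * side c], halfway through. *)
Definition circle (c : bool) (t : R) : R[i] :=
  (side c)%:C * (1 - expi (2 * pi * t)).

Lemma sideC_sqr c : (side c)%:C ^+ 2 = 1 :> R[i].
Proof. by case: c; rewrite /= ?rmorphN1 ?sqrrN ?expr1n. Qed.

Lemma circle_neq1 c t : circle c t ^+ 2 != 1.
Proof.
rewrite exprMn sideC_sqr mul1r sqrf_eq1 negb_or.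
rewrite -subr_eq0 addrAC subrr sub0r oppr_eq0 expi_neq0 /=.
apply/eqP => /(congr1 (@complex.Re R)); rewrite raddfB raddfN /=.
by have := cos_le1 (2 * pi * t); lra.
Qed.

Lemma circle_continuous c : continuous (circle c : R -> C).
Proof. by rewrite /circle; complex_continuous. Qed.

Lemma circle_int c (n : int) : circle c n%:~R = 0.
Proof. by rewrite /circle [2 * pi * _]mulrC expi_2pi_int subrr mulr0. Qed.

Definition circle_line c (t : R) : X := fiber (circle c t).

Lemma circle_line_continuous c : continuous (circle_line c).
Proof. exact: (fiber_continuous (@circle_continuous c) (circle_neq1 c)). Qed.

Lemma circle_line_int c (n : int) : circle_line c n%:~R = x0.
Proof. by rewrite /circle_line circle_int fiber0. Qed.

Lemma circle_is_loop c : is_loop x0 (circle_line c).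
Proof.
by split; [exact: circle_line_continuous|exact: (circle_line_int c
  0)|exact: (circle_line_int c 1)].
Qed.

Definition circle_class c : pi1 R x0 := pi1_of x0 (circle_line c).

Definition turn_line (t : R) : X := polar 0 (2 * pi * t) 1.

Lemma zero_neq1 : (0 : R[i]) ^+ 2 != 1.
Proof. by rewrite expr0n eq_sym oner_eq0. Qed.

Lemma turn_line_continuous : continuous turn_line.
Proof.
have c0 := @cst_continuous R C 0; have c1 := @cst_continuous R R 1.
have ct : continuous (fun t : R => 2 * pi * t) by real_continuous.
by apply: (polar_continuous c0 ct c1) => [_|_]; [exact: zero_neq1|exact: ltr01].
Qed.

Lemma turn_is_loop : is_loop x0 turn_line.
Proof.
split; first exact: turn_line_continuous.
  by rewrite /turn_line mulr0 polar_base.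
rewrite /turn_line mulr1 -polar_base; apply: val_inj.
rewrite !polarE ?ltr01 ?zero_neq1 // !mulr0 !mul0r expi0.
have -> // : expi (2 * pi) = 1 :> R[i].
by rewrite -[2 * pi]mul1r; exact: (expi_2pi_int 1).
Qed.

Definition turn_class : pi1 R x0 := pi1_of x0 turn_line.

Definition class_monodromy (u : pi1 R x0) (g : G) :=
  exists2 f, u = pi1_class f & monodromy f g.

Lemma class_monodromy_unique u g g' :
  class_monodromy u g -> class_monodromy u g' -> g = g'.
Proof.
case=> f -> mf [f' /pi1_classP ff' mf'].
exact: monodromy_homotopic ff' mf mf'.
Qed.

Lemma class_monodromy_total u : exists g, class_monodromy u g.
Proof.
rewrite -[u]pi1_classK; move: (repr u) => {u} f.
by have [g mg] := monodromy_total f; exists g, f.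
Qed.

Lemma class_monodromyM u u' g g' : class_monodromy u g ->
  class_monodromy u' g' -> class_monodromy (u * u')%g (g * g')%g.
Proof.
case=> f -> mf [f' -> mf']; exists (concat f f'); last exact: monodromyM.
by rewrite pi1_class_concat.
Qed.

Lemma class_monodromy_of F (g : G) t h : is_loop x0 F ->
  polar_lift (F \o @clampR R) t h -> t 0 = 0 -> h 0 = 1%g ->
  t 1 = (g.2 : int)%:~R * (2 * pi) -> h 1 = g.1 ->
  class_monodromy (pi1_of x0 F) g.
Proof.
move=> FP lF t0 h0 t1 h1; exists (mk_loop FP).
  by apply: pi1_ofE => // s sI; rewrite mk_loopE.
by exists t, h.
Qed.

Lemma turn_monodromy : class_monodromy turn_class ((1%g, 1) : G).
Proof.
pose t (s : R) : R := 2 * pi * clampR s.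
apply: (@class_monodromy_of _ ((1%g, 1) : G) t (fun=> 1%g)) => //.
- exact: turn_is_loop.
- split.
  + by rewrite /t; real_continuous.
  + by move=> s; rewrite /= normc_yco_polar ?yco_polar ?zero_neq1 ?ltr01.
  + rewrite (_ : (fun s => _) = fun=> 0).
      by move=> s i _; near=> u.
    by apply/funext => s; rewrite /= vco_polar ?zero_neq1 ?ltr01.
- by rewrite /t clampR_le0 // mulr0.
- by rewrite /t clampR_ge1 // mulr1 mul1r.
Unshelve. all: by end_near.
Qed.

Lemma sin_turn_gt0 (t : R) : 0 < t -> t < 2^-1 -> 0 < sin (2 * pi * t).
Proof.
move=> t0 t1; have p0 := @pi_gt0 R.
by apply: sin_gt0_pi; apply/andP; split; nra.
Qed.

Lemma sin_turn_lt0 (t : R) : 2^-1 < t -> t < 1 -> sin (2 * pi * t) < 0.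
Proof.
move=> t0 t1; have p0 := @pi_gt0 R.
have -> : 2 * pi * t = (2 * pi * t - pi) + pi by ring.
by rewrite sinDpi oppr_lt0; apply: sin_gt0_pi; apply/andP; split; nra.
Qed.

Lemma Re_side c (z : R[i]) : complex.Re ((side c)%:C * z) = side c * complex.Re
  z.
Proof. by case: z => a b /=; rewrite mul0r subr0. Qed.

Lemma Im_side c (z : R[i]) : complex.Im ((side c)%:C * z) = side c * complex.Im
  z.
Proof. by case: z => a b /=; rewrite mul0r addr0. Qed.

Lemma side_sqr c : side c * side c = 1 :> R.
Proof. by case: c => /=; lra. Qed.

Lemma Re_circle c t : complex.Re (circle c t) = side c * (1 - cos (2 * pi * t)).
Proof. by rewrite Re_side raddfB. Qed.

Lemma Im_circle c t : complex.Im (circle c t) = side c * (- sin (2 * pi * t)).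
Proof. by rewrite Im_side raddfB /= sub0r. Qed.

(** The cut is met only at time 1/2, where [side c * Im] passes from negative to positive. The
    strict inequality in [h] matches the closed one in [potential]: both give [fg_gen c] on the cut
    itself. *)
Lemma circle_adapted c : adapted (fun s : R => circle c (clampR s) : C)
  (fun s => if s < 2^-1 then 1%g else fg_gen c).
Proof.
have near_lt (s b : R) : s < b -> \forall u \near s, u < b.
  by move=> sb; exact: lt_nbhsl.
have near_gt (s b : R) : b < s -> \forall u \near s, b < u.
  by move=> sb; exact: lt_nbhsr.
apply: adapted_intro => [|s].
  exact: (continuous_compT (@circle_continuous c) (@clampR_continuous R)).
have chart_away : s != 2^-1 -> chart None (circle c (clampR s) : C).
  move=> s2; have [s0|s0] := leP s 0.
    by rewrite clampR_le0 // (circle_int c 0); exact: chart_base.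
  have [s1|s1] := leP 1 s.
    by rewrite clampR_ge1 // (circle_int c 1); exact: chart_base.
  left; rewrite clampR_id ?(ltW s0) ?(ltW s1) // Im_circle mulf_neq0 //.
    by case: (c); rewrite ?oppr_eq0 oner_eq0.
  rewrite oppr_eq0; have [sl|sr|/eqP] := ltgtP s 2^-1;
    last by rewrite (negPf s2).
    by rewrite gt_eqF // sin_turn_gt0.
  by rewrite lt_eqF // sin_turn_lt0.
have [sl|sr|s2] : [\/ s < 2^-1, 2^-1 < s | s = 2^-1].
  by case: ltgtP; constructor.
- exists None; first by apply: chart_away; rewrite lt_eqF.
  by apply: filterS (near_lt _ _ sl) => u ->; rewrite sl.
- exists None; first by apply: chart_away; rewrite gt_eqF.
  apply: filterS (near_gt _ _ sr) => u ur.
  by rewrite !ifF //; apply/negbTE; rewrite -leNgt ltW.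
have cl2 : clampR 2^-1 = 2^-1 :> R by apply: clampR_id; lra.
have p2 : 2 * pi * 2^-1 = pi :> R by field.
exists (Some c).
  by rewrite /chart s2 cl2 Re_circle mulrA side_sqr p2 cospi; lra.
have n0 : \forall u \near s, 0 < u by apply: near_gt; lra.
have n1 : \forall u \near s, u < 1 by apply: near_lt; lra.
have E (u : R) : 0 < u -> u < 1 -> ((if (u < 2^-1)%R then 1 else fg_gen c) *
    (potential (Some c) (circle c (clampR u) : C))^-1)%g = 1%g :> F2.
  move=> u0 u1; rewrite /potential clampR_id ?(ltW u0) ?(ltW u1) // Im_circle
    mulrA side_sqr mul1r.
  rewrite oppr_ge0; have [ul|ur|->] := ltgtP u 2^-1.
  - by rewrite leNgt sin_turn_gt0 // mulgV.
  - by rewrite ltW ?sin_turn_lt0 // mulgV.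
  - by rewrite p2 sinpi lexx mulgV.
apply: filterS2 n0 n1 => u u0 u1; rewrite E // E //; lra.
Qed.

Lemma circle_monodromy c : class_monodromy (circle_class c) ((fg_gen c, 0) : G).
Proof.
pose h (s : R) : F2 := if s < 2^-1 then 1%g else fg_gen c.
apply: (@class_monodromy_of _ ((fg_gen c, 0) : G) (fun=> 0) h) => //.
- exact: circle_is_loop.
- split.
  + exact: cst_continuous.
  + by move=> s; rewrite /= normc_yco_polar ?yco_polar ?circle_neq1 ?ltr01.
  + have := @circle_adapted c.
    rewrite (_ : (fun s : R => _) = fun s => vco ((circle_line c \o @clampR R)
      s) 0) //.
    by apply/funext => s; rewrite /= vco_polar ?circle_neq1 ?ltr01.
- by rewrite /h ifT // invr_gt0.
- by rewrite mul0r.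
- by rewrite /h ifF //; lra.
Qed.

End Generators.

(** * Loops of trivial winding are words in the generators *)

Lemma multiplicative1 (G H : groupType) (f : {multiplicative G ->
  H}) : f 1%g = 1%g.
Proof. by apply: (mulgI (f 1%g)); rewrite -gmulfM !mulg1. Qed.

Lemma multiplicativeV (G H : groupType) (f : {multiplicative G -> H}) u :
  f u^-1%g = (f u)^-1%g.
Proof. by apply: (mulgI (f u)); rewrite -gmulfM !mulgV multiplicative1. Qed.

Section Generation.
Context {R : realType}.
Local Notation C := R[i]^o.
Local Notation x0 := (@locus_base R).

Definition circle_word (u : pi1 R x0) :=
  exists w : F2, u = fg_lift (@circle_class R) w.

Lemma circle_word1 : circle_word 1%g.
Proof. by exists 1%g. Qed.

Lemma circle_wordM u v : circle_word u -> circle_word v ->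
  circle_word (u * v)%g.
Proof. by case=> w -> [w' ->]; exists (w * w')%g; rewrite gmulfM. Qed.

Lemma circle_wordV u : circle_word u -> circle_word u^-1%g.
Proof. by case=> w ->; exists w^-1%g; rewrite multiplicativeV. Qed.

Lemma circle_word_class c : circle_word (circle_class c).
Proof. by exists (fg_gen c); rewrite fg_lift_gen. Qed.

Lemma circle_word_turns c (n : int) :
  circle_word (pi1_of x0 (subpath (circle_line c) 0 n%:~R)).
Proof.
have cF := @circle_line_continuous R c.
have F0 := @circle_line_int R c.
have step (m : int) : pi1_of x0 (subpath (circle_line c) 0 (m + 1)%:~R) =
    (pi1_of x0 (subpath (circle_line c) 0 m%:~R) * circle_class c)%g.
  rewrite (@pi1_subpath_cat _ _ _ _ 0 m%:~R (m + 1)%:~R) ?F0 //;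
    last exact: (F0 0).
  congr (_ * pi1_of _ _)%g; apply/funext => t; rewrite /subpath /circle_line.
  congr fiber; rewrite /circle; congr (_ * (1 - _)).
  have -> : 2 * pi * (m%:~R + t * ((m + 1)%:~R - m%:~R)) = m%:~R * (2 * pi) + 2
    * pi * t.
    by rewrite intrD; ring.
  by rewrite expiD expi_2pi_int mul1r.
elim/int_rect: n => [|n IHn|n IHn].
- rewrite (_ : subpath _ 0 _ = cst x0); first by rewrite pi1_of_cst;
  exact: circle_word1.
  by apply/funext => t; rewrite /subpath subrr mulr0 addr0; exact: (F0 0).
- have -> : n.+1%:Z = n%:Z + 1 by lia.
  by rewrite step; apply: circle_wordM => //; exact: circle_word_class.
- have := step (- n.+1%:Z).
  have -> : - n.+1%:Z + 1 = - n%:Z by lia.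
  (* For a negative number of turns the recursion is solved backwards. *)
  move=> e; rewrite -[X in circle_word X](mulgK (circle_class c)) -e.
  apply: circle_wordM => //; exact/circle_wordV/circle_word_class.
Qed.

(** Projection onto the closed right half-plane. It never takes the value -1, and takes the value 1
    only at 1; so a homotopy that avoids just the puncture 1 is made to avoid both. *)
Definition fold (z : R[i]) : R[i] := Num.max 0 (complex.Re z) +i* complex.Im z.

Lemma fold_continuous (S : topologicalType) (z : S -> C) : continuous z ->
  continuous (fun s => fold (z s) : C).
Proof.
move=> cz; have cr := continuous_Re cz; have ci := continuous_Im cz.
apply: Complex_continuous => //.
by complex_continuous.
Qed.

Lemma fold_id (z : R[i]) : 0 <= complex.Re z -> fold z = z.
Proof. by case: z => a b /= a0; rewrite /fold /= max_r. Qed.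

Lemma fold_neq1 (z : R[i]) : z != 1 -> fold z ^+ 2 != 1.
Proof.
move=> z1; rewrite sqrf_eq1 negb_or; apply/andP; split.
  apply: contra z1; case: z => a b; rewrite !eq_complex /= => /andP[/eqP m1 ->].
  rewrite andbT; move: m1; case: (leP 0 a) => _ => [->//|/eqP].
  by rewrite eq_sym oner_eq0.
apply/eqP => /(congr1 (@complex.Re R)); rewrite raddfN /= => m1.
have : 0 <= Num.max 0 (complex.Re z) by rewrite le_max lexx.
by rewrite m1; lra.
Qed.

Definition one_sided (v : R -> R[i]) c (a b : R) :=
  forall t, a <= t <= b -> 0 <= side c * complex.Re (v t).

(* A loop with values in a half-plane winds around the single puncture of that
   half-plane: its polar coordinates around this puncture are straightened,
   and the homotopy is folded back into the half-plane. *)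
Lemma circle_word_one_sided (v : R -> C) c (a b : R) : continuous v ->
  (forall t, v t ^+ 2 != 1) -> a <= b -> v a = 0 -> v b = 0 ->
    one_sided v c a b ->
  circle_word (pi1_of x0 (subpath (fun t => fiber (v t)) a b)).
Proof.
move=> cv v1 ab va vb ov.
have cF := fiber_continuous cv v1.
have FP : is_loop x0 (subpath (fun t => fiber (v t)) a b).
  by apply: subpath_is_loop => //; rewrite ?va ?vb fiber0.
pose sc : R[i] := (side c)%:C.
pose u (t : R) : C := sc * v (a + t * (b - a)).
have cu : continuous u by rewrite /u; complex_continuous.
have uu t : sc * u t = v (a + t * (b - a)).
  by rewrite /u mulrA -expr2 sideC_sqr mul1r.
have u1 t : 1 - u t != 0.
  rewrite subr_eq0; apply: contra (v1 (a + t * (b - a))) => /eqP e.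
  by apply/eqP; rewrite -uu -e mulr1; exact: sideC_sqr.
have cz : continuous (fun p : R * R => 1 - u p.1 : C).
  by complex_continuous.
have [th cth thE] := angle_lift cz (fun p => u1 p.1).
have u_0 : u 0 = 0 by rewrite /u mul0r addr0 va mulr0.
have u_1 : u 1 = 0 by rewrite /u mul1r subrKC vb mulr0.
have zE (t : R) : 0 <= t <= 1 -> 1 - u t = (normc (1 - u t))%:C * expi (th (t,
  0)).
  by move=> tI; have := thE (t, 0); rewrite /= clampR_id.
have expi_end (t : R) : 0 <= t <= 1 -> u t = 0 -> expi (th (t, 0)) = 1.
  by move=> tI ut; have := zE t tI; rewrite ut subr0 normc1 mul1r.
have I0 : 0 <= (0 : R) <= 1 by rewrite lexx ler01.
have I1 : 0 <= (1 : R) <= 1 by rewrite lexx ler01.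
pose ph t := th (t, 0) - th (0, 0).
have cph : continuous ph by rewrite /ph; real_continuous.
have phE (t : R) : 0 <= t <= 1 -> 1 - u t = (normc (1 - u t))%:C * expi (ph t).
  by move=> tI; rewrite /ph expiB (expi_end 0) // divr1; exact: zE.
have ph0 : ph 0 = 0 by rewrite /ph subrr.
have [n phn] : exists n : int, ph 1 = n%:~R * (2 * pi).
  by apply: expi_eq1; rewrite /ph expiB !expi_end // divr1.
(* Modulus and angle of [1 - u] are interpolated linearly, towards 1 and towards [n] uniform turns.
   The modulus stays positive, so [Z] avoids 1; at both ends the modulus is 1 and the angle a
   multiple of 2 pi, so [Z] is 0 there. *)
pose rho (p : R * R) := (1 - clampR p.2) * normc (1 - u p.1) + clampR p.2.
pose ang (p : R * R) := (1 - clampR p.2) * ph p.1 + clampR p.2 * (2 * pi *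
  (n%:~R * p.1)).
pose Z (p : R * R) : C := 1 - (rho p)%:C * expi (ang p).
have rho0 p : 0 < rho p.
  have r0 := normc_gt0 (u1 p.1); have /andP[s0 s1] := clampR01 p.2.
  rewrite /rho; have [e|ne] := eqVneq (clampR p.2) 0.
    by rewrite e subr0 mul1r addr0.
  by apply: ltr_wpDl; [rewrite mulr_ge0 ?subr_ge0 // ltW|rewrite lt_neqAle
    eq_sym ne].
have crho : continuous rho by rewrite /rho; complex_continuous.
have cang : continuous ang by rewrite /ang; complex_continuous.
have cZ : continuous Z by rewrite /Z; complex_continuous.
have Z1 p : Z p != 1.
  rewrite /Z -subr_eq0 addrAC subrr sub0r oppr_eq0 mulf_neq0 ?expi_neq0 //.
  by apply/eqP => /(congr1 (@complex.Re R)) /= e; have := rho0 p;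
    rewrite e ltxx.
pose V (p : R * R) : C := sc * fold (Z p).
have cfZ := fold_continuous cZ.
have cV : continuous V by rewrite /V; complex_continuous.
have V1 p : V p ^+ 2 != 1 by rewrite exprMn sideC_sqr mul1r fold_neq1.
have Z0 (p : R * R) : u p.1 = 0 -> expi (ang p) = 1 -> Z p = 0.
  move=> up ep; rewrite /Z ep mulr1 /rho up subr0 normc1 mulr1 subrK.
  by rewrite subrr.
have ZL s : Z (0, s) = 0.
  by apply: Z0 => //; rewrite /ang /= ph0 !mulr0 addr0 expi0.
have ZR s : Z (1, s) = 0.
  apply: Z0 => //; rewrite /ang /= phn mulr1 [2 * pi * _]mulrC -mulrDl subrK
    mul1r.
  exact: expi_2pi_int.
have VZ0 p : Z p = 0 -> V p = 0 by move=> e; rewrite /V e fold_id ?mulr0 //=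
  lexx.
have := circle_word_turns c n.
rewrite -(@pi1_of_homotopy _ _ x0 (subpath (fun t =>
  fiber (v t)) a b) _ (fun p => fiber (V p))) //.
- by apply: subpath_is_loop => //;
  [exact: circle_line_continuous|exact: (circle_line_int c
  0)|exact: circle_line_int].
- exact: fiber_continuous.
- move=> t tI; rewrite /subpath; congr fiber; rewrite /V.
  have -> : Z (t, 0) = u t.
    rewrite /Z /rho /ang /= [clampR 0]clampR_le0 // subr0 !mul1r mul0r !addr0.
    by rewrite -phE // subKr.
  rewrite fold_id ?uu // /u Re_side; apply: ov.
  have /andP[t0 t1] := tI.
  have ? : 0 <= t * (b - a) by rewrite mulr_ge0 ?subr_ge0.
  have ? : 0 <= (1 - t) * (b - a) by rewrite mulr_ge0 ?subr_ge0.
  by apply/andP; split; lra.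
- move=> t tI; rewrite /subpath /circle_line; congr fiber; rewrite /V /circle.
  have -> : Z (t, 1) = 1 - expi (2 * pi * (0 + t * (n%:~R - 0))).
    rewrite /Z /rho /ang /= [clampR 1]clampR_ge1 // subrr !mul0r !add0r !mul1r.
    by rewrite subr0 [t * _]mulrC.
  rewrite fold_id //= subr_ge0; exact: cos_le1.
- by move=> s _; rewrite VZ0 ?fiber0.
- by move=> s _; rewrite VZ0 ?fiber0.
Qed.

End Generation.

Section Collapse.
Context {R : realType}.
Local Notation C := R[i]^o.
Local Notation x0 := (@locus_base R).
Local Notation G := (semidirect (zpow swap)).

(** Again a Lebesgue number, now giving one length for intervals on which the real part keeps a
    side. *)
Lemma locally_one_sided (v : R -> C) :
  (forall p : R, exists c, \forall q \near p, 0 <= side c * complex.Re (v q)) ->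
  exists2 n : nat, (0 < n)%N & forall a, 0 <= a <= 1 ->
    exists c, one_sided v c a (a + n%:R^-1).
Proof.
move=> lv.
have /compact_near_coveringP/(_ _ (0^'+ : set_system R)
    (fun e p => exists c, one_sided v c p (p + e))) :
  compact `[0 : R, 1]%classic by exact: segment_compact.
case=> [p _|e /= e0 He].
  have [c /nbhs_ballP[e /= e0 ev]] := lv p.
  near=> q e'; exists c => t /= /andP[qt tq]; apply: ev.
  have : ball p (e / 2) q by near: q; apply: nbhsx_ballx; rewrite divr_gt0.
  have e'e : e' < e / 2 by near: e'; apply: nbhs_right_lt; rewrite divr_gt0.
  rewrite /ball /= !ltr_norml => /andP[? ?].
  by apply/andP; split; lra.
exists (Num.trunc (e / 2)^-1).+1 => // a a01.
have be : ball (0 : R) e (e / 2) by rewrite /ball /= sub0r normrN ger0_norm;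
  lra.
have e2 : 0 < e / 2 by lra.
have a01' : `[0 : R, 1]%classic a by rewrite /= in_itv.
have [c oc] := He (e / 2) be e2 a a01'; exists c => t /andP[ta1 ta2].
apply: oc; rewrite ta1 (le_trans ta2) // lerD2l.
rewrite -[leRHS]invrK lef_pV2 ?posrE ?invr_gt0 ?ltr0n //.
by apply/ltW; rewrite truncnS_gt.
Unshelve. all: by end_near.
Qed.

(** A subdivision point can serve as a cut only if [v] vanishes there. The induction keeps the last
    cut [a] and one side up to [T k]; where [v] does not vanish its real part is nonzero, so the
    next interval has the same side and is merged. *)
Lemma circle_word_subdivide (v : R -> C) : continuous v ->
  (forall t, v t ^+ 2 != 1) -> v 0 = 0 -> v 1 = 0 ->
  (forall t, complex.Re (v t) = 0 -> v t = 0) ->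
  (forall p : R, exists c, \forall q \near p, 0 <= side c * complex.Re (v q)) ->
  circle_word (pi1_of x0 (fun t => fiber (v t))).
Proof.
move=> cv v1 v_0 v_1 Re0 lv; have [n n0 nv] := locally_one_sided lv.
have nR : 0 < n%:R :> R by rewrite ltr0n.
pose F t := fiber (v t); pose T (k : nat) : R := k%:R / n%:R.
have cF : continuous F by exact: fiber_continuous.
have F0 t : v t = 0 -> F t = x0 by move=> vt; rewrite /F vt fiber0.
have T0 : T 0%N = 0 by rewrite /T mul0r.
have T1 : T n = 1 by rewrite /T divff // gt_eqF.
have TS k : T k.+1 = T k + n%:R^-1 by rewrite /T -natr1 mulrDl mul1r.
have Tge k : 0 <= T k by rewrite /T divr_ge0.
have nV : 0 < n%:R^-1 :> R by rewrite invr_gt0.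
have wcat a b c : v a = 0 -> v b = 0 -> a <= b -> one_sided v c a b ->
    circle_word (pi1_of x0 (subpath F 0 a)) ->
      circle_word (pi1_of x0 (subpath F 0 b)).
  move=> va vb ab oc wa; rewrite (@pi1_subpath_cat _ _ x0 F 0 a b) ?F0 //.
  apply: circle_wordM => //; exact: (circle_word_one_sided cv v1 ab va vb oc).
have main k : (k <= n)%N -> exists a c, [/\ v a = 0, a <= T k,
    one_sided v c a (T k) & circle_word (pi1_of x0 (subpath F 0 a))].
  elim: k => [_|k IHk kn].
    exists 0, false; split; rewrite ?T0 //.
      by move=> t /le_anti <-; rewrite v_0 mulr0.
    rewrite (_ : subpath _ 0 _ = cst x0); first by rewrite pi1_of_cst;
      exact: circle_word1.
    by apply/funext => t; rewrite /subpath subrr mulr0 addr0 F0.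
  have [a [c [va ak oc wa]]] := IHk (ltnW kn).
  have [|c' oc'] := nv (T k).
    by rewrite Tge -T1 ler_pM2r // ler_nat ltnW.
  rewrite -TS in oc'; have kS : T k <= T k.+1 by rewrite TS lerDl ltW.
  have [vk|vk] := eqVneq (v (T k)) 0.
    by exists (T k), c'; split=> //; exact: (wcat a _ c).
  have cc : c' = c.
    have k1 := oc (T k); have k2 := oc' (T k).
    rewrite ak lexx in k1; rewrite kS lexx in k2.
    have {}k1 := k1 isT; have {}k2 := k2 isT.
    apply/eqP; apply: contraNT vk => ne; apply/eqP/Re0.
    have e : side c' = - side c :> R by rewrite -side_negb; case: (c) (c') ne =>
      [] [].
    rewrite e in k2.
    have : side c * complex.Re (v (T k)) = 0 by lra.
    by move/eqP; rewrite mulf_eq0 => /orP[|/eqP//]; case: (c) => /=;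
      rewrite ?oppr_eq0 oner_eq0.
  exists a, c; split=> //; first exact: le_trans kS.
  move=> t /andP[t1 t2]; have [tk|/ltW tk] := leP t (T k).
    by apply: oc; rewrite t1.
  by rewrite -cc; apply: oc'; rewrite tk.
have [a [c [va a1 oc wa]]] := main n (leqnn n).
rewrite T1 in a1 oc.
by have := wcat a 1 c va v_1 a1 oc wa; rewrite subpath01.
Qed.

(** Equal to 0 up to 1/4 and to 1 from 1/2 on: scaling [v] by its value at the real part sends a
    strip to 0 and fixes the part of the plane that contains the punctures. *)
Definition cutoff (x : R) : R := clampR (4 * `|x| - 1).

Lemma cutoff01 x : 0 <= cutoff x <= 1. Proof. exact: clampR01. Qed.

Lemma cutoff_small x : `|x| <= 4^-1 -> cutoff x = 0.
Proof. by move=> x1; rewrite /cutoff clampR_le0 //; lra. Qed.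

Lemma cutoff_large x : 2^-1 <= `|x| -> cutoff x = 1.
Proof. by move=> x1; rewrite /cutoff clampR_ge1 //; lra. Qed.

Lemma cutoff_continuous : continuous cutoff.
Proof.
have cn : continuous (fun x : R => `|x|) by exact: norm_continuous.
by rewrite /cutoff; real_continuous.
Qed.

(* Collapsing a vertical strip around the origin makes every loop locally
   one-sided. *)
Lemma circle_word_fiber (v : R -> C) : continuous v ->
  (forall t, v t ^+ 2 != 1) -> v 0 = 0 -> v 1 = 0 ->
  circle_word (pi1_of x0 (fun t => fiber (v t))).
Proof.
move=> cv v1 v_0 v_1.
pose k (p : R * R) := (1 - clampR p.2) + clampR p.2 * cutoff (complex.Re (v
  p.1)).
have cRe := continuous_Re cv.
have ck : continuous k.
  by have cc := cutoff_continuous; rewrite /k; complex_continuous.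
pose V (p : R * R) : C := (k p)%:C * v p.1.
have cV : continuous V by rewrite /V; complex_continuous.
have ReV p : complex.Re (V p) = k p * complex.Re (v p.1).
  by rewrite /V; case: (v p.1) => a b /=; rewrite mul0r subr0.
have k1 p : 2^-1 <= `|complex.Re (v p.1)| -> k p = 1.
  by move=> h; rewrite /k cutoff_large // mulr1 subrK.
have k01 p : 0 <= k p <= 1.
  have /andP[s0 s1] := clampR01 p.2; have /andP[c0 c1] :=
    cutoff01 (complex.Re (v p.1)).
  by rewrite /k; apply/andP; split; nra.
have V1 p : V p ^+ 2 != 1.
  (* Either [V] is [v] itself, or its real part is smaller than 1 in absolute value and it cannot be
     a puncture. *)
  have [h|h] := leP 2^-1 `|complex.Re (v p.1)|.
    by rewrite /V k1 // mul1r v1.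
  rewrite sqrf_eq1 negb_or; have /andP[k0 k2] := k01 p.
  have hV : `|complex.Re (V p)| < 1.
    rewrite ReV normrM ger0_norm // (le_lt_trans (ler_piMl _ k2)) //.
    by rewrite (lt_trans h) // invf_lt1 // ltr1n.
  apply/andP; split; apply: contraTN hV => /eqP ->; rewrite -leNgt.
    by rewrite normr1.
  by rewrite raddfN normrN normr1.
have kz t : cutoff (complex.Re (v t)) = k (t, 1).
  by rewrite /k /= clampR_ge1 // subrr add0r mul1r.
have V0 p : v p.1 = 0 -> V p = 0 by move=> e; rewrite /V e mulr0.
pose w t := V (t, 1).
have ct : continuous (fun t : R => (t, 1 : R)) by real_continuous.
have cw : continuous w by exact: (continuous_compT cV ct).
rewrite (@pi1_of_homotopy _ _ x0 _ (fun t => fiber (w t)) (fun p =>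
  fiber (V p))).
- apply: circle_word_subdivide => //.
  + by move=> t; exact: V1.
  + exact: V0.
  + exact: V0.
  + move=> t; rewrite ReV /w /V => /eqP; rewrite mulf_eq0 => /orP[/eqP ->
    |/eqP r0].
      by rewrite mul0r.
    by rewrite -kz r0 cutoff_small ?mul0r // normr0 invr_ge0.
  (* The bound -1/4 leaves room: real parts slightly on the wrong side are collapsed to 0. So the
     condition is open, and each point satisfies it for one of the sides. *)
  + have sided c p : - 4^-1 < side c * complex.Re (v p) ->
        0 <= side c * complex.Re (w p).
      move=> h; rewrite ReV /= mulrCA.
      have [h2|h2] := leP `|complex.Re (v p)| 4^-1.
        by rewrite -kz cutoff_small ?mul0r.
      have /andP[k0 _] := k01 (p, 1); rewrite mulr_ge0 //.
      have ns : `|side c * complex.Re (v p)| = `|complex.Re (v p)|.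
        by case: (c); rewrite /= ?mulN1r ?mul1r ?normrN.
      rewrite -ns in h2; move: h2; case: (ger0P (side c * complex.Re (v p))) =>
        // n0; lra.
    move=> p; have cs c : continuous (fun q =>
      side c * complex.Re (v q) + 4^-1) by real_continuous.
    have [p0|p0] := leP 0 (complex.Re (v p)).
      exists false; have : 0 < side false * complex.Re (v p) + 4^-1
        by rewrite /=; lra.
      by move/(continuous_gt0 (cs false)); apply: filterS => q q0; apply: sided;
        lra.
    exists true; have : 0 < side true * complex.Re (v p) + 4^-1 by rewrite /=;
      lra.
    by move/(continuous_gt0 (cs true)); apply: filterS => q q0; apply: sided;
      lra.
- by split; [exact: (fiber_continuous cv v1)|rewrite v_0 fiber0|rewrite v_1
  fiber0].
- split; first by apply: fiber_continuous => // t; exact: V1.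
    by rewrite /w V0 ?fiber0.
  by rewrite /w V0 ?fiber0.
- exact: (fiber_continuous cV V1).
- move=> t _; congr fiber; rewrite /V /k /= [clampR 0]clampR_le0 //.
  by rewrite subr0 mul0r addr0 mul1r.
- by [].
- by move=> s _; rewrite V0 ?fiber0.
- by move=> s _; rewrite V0 ?fiber0.
Qed.

(** With no net turn the argument and modulus form a loop in a convex set; moving them linearly to 0
    and 1 with v fixed brings the loop into the fiber y = 1. The ends stay at the base point since v
    = 0 there. *)
Lemma monodromy_fiber f (g : G) : monodromy f g -> g.2 = 1%g ->
  exists w : F2, pi1_class f = fg_lift (@circle_class R) w.
Proof.
case=> t [h [[ct tE ah] t0 h0 t1 h1]] g2.
have {}t1 : t 1 = 0 by rewrite t1 g2 mul0r.
have cf := @loop_line_continuous _ _ _ f.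
pose v s : C := vco (loop_line f s) (t s).
have cv : continuous v by exact: vco_continuous.
have v1 s : v s ^+ 2 != 1 by exact: vco_neq1.
have f0 : loop_line f 0 = x0 by rewrite loop_line_le0.
have f1 : loop_line f 1 = x0 by rewrite loop_line_ge1.
have v_0 : v 0 = 0 by rewrite /v f0 vco_base.
have v_1 : v 1 = 0 by rewrite /v f1 vco_base.
have [w ww] := circle_word_fiber cv v1 v_0 v_1; exists w;
  rewrite -ww -pi1_of_line.
pose y s := normc (yco (loop_line f s)).
have cy : continuous y.
  have cyf := continuous_compT (@yco_continuous R) cf.
  exact: (continuous_normc cyf).
have y0 s : 0 < y s by exact: normc_yco_gt0.
have y_0 : y 0 = 1 by rewrite /y f0 yco_base normc1.
have y_1 : y 1 = 1 by rewrite /y f1 yco_base normc1.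
pose T (p : R * R) := (1 - clampR p.2) * t p.1.
pose Y (p : R * R) := (1 - clampR p.2) * y p.1 + clampR p.2.
have cT : continuous T by rewrite /T; real_continuous.
have cY : continuous Y by rewrite /Y; real_continuous.
have Y0 p : 0 < Y p.
  have r0 := y0 p.1; have /andP[s0 s1] := clampR01 p.2.
  rewrite /Y; have [e|ne] := eqVneq (clampR p.2) 0.
    by rewrite e subr0 mul1r addr0.
  by apply: ltr_wpDl; [rewrite mulr_ge0 ?subr_ge0 // ltW|rewrite lt_neqAle
    eq_sym ne].
have cv1 : continuous (fun p : R * R => v p.1 : C) by exact: (continuous_compT
  cv continuous_fstT).
apply: (@pi1_of_homotopy _ _ _ _ _ (fun p => polar (v p.1) (T p) (Y p))).
- exact: loop_line_is_loop.
- by split; [exact: (fiber_continuous cv v1)|rewrite v_0 fiber0|rewrite v_1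
  fiber0].
- exact: (polar_continuous cv1 cT cY (fun p => v1 p.1) Y0).
- move=> s _; rewrite /T /Y /= [clampR 0]clampR_le0 // subr0 !mul1r addr0.
  exact: (polar_vco (tE s)).
- by move=> s _; rewrite /T /Y /= [clampR 1]clampR_ge1 // subrr !mul0r add0r.
- by move=> s _; rewrite /T /Y /= v_0 t0 y_0 mulr0 mulr1 subrK polar_base.
- by move=> s _; rewrite /T /Y /= v_1 t1 y_1 mulr0 mulr1 subrK polar_base.
Qed.

End Collapse.

(** * The isomorphism *)

Section Conclusion.
Context {R : realType}.
Local Notation C := R[i]^o.
Local Notation X := (kepler_regular_locus R).
Local Notation x0 := (@locus_base R).
Local Notation G := (semidirect (zpow swap)).

Lemma pi1_base_iso : exists2 Phi : pi1 R x0 -> G,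
  {morph Phi : u v / (u * v)%g} & bijective Phi.
Proof.
have /choice[Phi PhiP] := @class_monodromy_total R.
have PhiM : {morph Phi : u v / (u * v)%g}.
  by move=> u v; apply: (class_monodromy_unique (PhiP _));
    exact: class_monodromyM.
have PhiE u g : class_monodromy u g -> Phi u = g.
  by move=> ug; exact: (class_monodromy_unique (PhiP u) ug).
pose PhiX : {multiplicative pi1 R x0 -> G} :=
  HB.pack Phi (isMultiplicative.Build _ _ Phi PhiM).
have Phi1 : Phi 1%g = 1%g by exact: (multiplicative1 PhiX).
have PhiV u : Phi u^-1%g = (Phi u)^-1%g by exact: (multiplicativeV PhiX).
pose inF (w : F2) : G := (w, 1%g).
have inFM : {morph inF : u v / (u * v)%g}.
  by move=> u v; congr pair.
pose inFX : {multiplicative F2 -> G} := HB.pack inF (isMultiplicative.Build _ _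
  inF inFM).
pose words : {multiplicative F2 -> pi1 R x0} :=
  @fg_lift bool (pi1 R x0) (@circle_class R).
(* Both sides are homomorphisms from F_2, so the two circles decide. *)
have Phi_words w : Phi (fg_lift (@circle_class R) w) = (w, 1%g).
  transitivity ((PhiX \o words) w) => //.
  rewrite (fg_lift_unique (PhiX \o words)) [RHS](fg_lift_unique inFX w).
  congr (fg_lift _ w); apply/funext => c /=.
  by rewrite fg_lift_gen; apply: PhiE; exact: circle_monodromy.
have Phi_turns (n : int) : Phi (zpow (@turn_class R) n) = (1%g, n).
  have turn1 : Phi (@turn_class R) = ((1%g, 1) : G) by apply: PhiE;
    exact: turn_monodromy.
  elim/int_rect: n => [|n IHn|n IHn].
  - exact: Phi1.
  - have -> : n.+1%:Z = n%:Z + 1 by lia.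
    rewrite zpowS PhiM IHn turn1; congr pair => /=.
    by rewrite mul1g; exact: (aut1 (zpow swap n)).
  - have -> : - n.+1%:Z = - n%:Z - 1 by lia.
    rewrite zpow_pred PhiM PhiV IHn turn1; congr pair => /=.
    by rewrite mul1g; exact: (aut1 (zpow swap (- n%:Z))).

have surj g : exists u, Phi u = g.
  (* This is the factorization (w, n) = (w, 1) (1, n). *)
  exists (fg_lift (@circle_class R) g.1 * zpow (@turn_class R) g.2)%g.
  rewrite PhiM Phi_words (Phi_turns g.2) [RHS]surjective_pairing; congr pair.
    exact: mulg1.
  exact: (mul1g g.2).
have inj : injective Phi.
  move=> u v uv; apply/esym/(mulgI u^-1%g); rewrite mulVg.
  have : Phi (u^-1 * v)%g = 1%g by rewrite PhiM PhiV uv mulVg.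
  move: (u^-1 * v)%g => x Px; have [f xf mf] := PhiP x.
  rewrite Px in mf; have [w fw] := monodromy_fiber mf erefl.
  move: Px; rewrite xf fw Phi_words => -[->].
  exact: (multiplicative1 words).
exists Phi => //; have /choice[Psi PsiP] := surj.
by exists Psi => // u; apply: inj; rewrite PsiP.
Qed.

(** The segment from [z] to 1 can meet 0 only if [z] is real; in that case the bump [t * (1 - t)] is
    added to the imaginary part. *)
Lemma segment_neq0 (z : C) : z != 0 ->
  exists2 y : R -> C, continuous y & [/\ y 0 = z, y 1 = 1 & forall t,
    y (clampR t) != 0].
Proof.
move=> z0.
pose k : R := if complex.Im z == 0 then 1 else 0.
pose y (t : R) : C := ((1 - t) * complex.Re z + t) +i* ((1 - t) * complex.Im z +
  k * (t * (1 - t))).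
exists y.
  by apply: Complex_continuous; real_continuous.
split.
- by rewrite /y subr0 !mul1r !mul0r mulr0 !addr0; case: (z).
- by rewrite /y subrr !mul0r !mulr0 add0r addr0.
move=> s; set t := clampR s; have /andP[t0 t1] : 0 <= t <= 1 by exact: clampR01.
apply/eqP => /eqP; rewrite eq_complex /= => /andP[/eqP yr /eqP yi].
move: yi; rewrite /k; case: eqP => [i0|/eqP i0].
  rewrite i0 mulr0 add0r mul1r => /eqP; rewrite mulf_eq0 subr_eq0 =>
    /orP[]/eqP te.
    move/negP: z0; apply; rewrite eq_complex i0 eqxx andbT.
    by move: yr; rewrite te subr0 mul1r addr0 => ->.
  by move: yr; rewrite -te subrr mul0r add0r => /eqP; rewrite oner_eq0.
rewrite mul0r addr0 => /eqP; rewrite mulf_eq0 (negPf i0) orbF subr_eq0 =>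
  /eqP te.
by move: yr; rewrite -te subrr mul0r add0r => /eqP; rewrite oner_eq0.
Qed.

(** With y fixed, x is scaled by [b] from 1 to 0, and 1 + [m] b^2 must not vanish. A real factor
    [1 - t] works when [m] is not real. Otherwise b = (1 - t)(1 + it), whose square has imaginary
    part 2 t (1 - t)^2, so only the ends remain to be checked. *)
Lemma path_to_axis (p : X) : exists2 g : R -> X, continuous g &
  g 0 = p /\ g 1 = to_locus (0, yco p).
Proof.
have [y0 yp] := locusP p; set x := xco p in yp; set y := yco p in y0 yp.
pose m : R[i] := 2 * x ^+ 2 * y.
have m1 : m != -1 by apply: contra yp => /eqP e; rewrite -/m e subrr.
pose k : R := if complex.Im m == 0 then 1 else 0.
pose b (t : R) : R[i] := (1 - t) +i* (k * (t * (1 - t))).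
have cb : continuous (fun t => b (clampR t) : C).
  by apply: Complex_continuous; real_continuous.
have bm (t : R) : 0 <= t <= 1 -> 1 + m * b t ^+ 2 != 0.
  move=> /andP[t0 t1]; apply/eqP => e.
  have [eR eI] : complex.Re (1 + m * b t ^+ 2) = 0 /\ complex.Im (1 + m * b t ^+
    2) = 0.
    by rewrite e.
  move: eR eI m1; rewrite /b /k expr2; case: (m) => u v /=.
  rewrite eq_complex /=; case: eqP => [-> eR eI|/eqP v0 eR eI _].
    rewrite oppr0 eqxx andbT => /eqP; apply.
    have : u * ((1 - t) * (1 - t) * t) = 0 by lra.
    have [te|tn] := eqVneq t 0; first by move=> _; move: eR; rewrite te; lra.
    have [t1'|tn1] := eqVneq (1 - t) 0; first by move: eR; rewrite t1'; lra.
    move=> /eqP; rewrite !mulf_eq0 (negPf tn) (negPf tn1) !orbF => /eqP u0.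
    by move: eR; rewrite u0; lra.
  have : v * ((1 - t) * (1 - t)) = 0 by lra.
  move=> /eqP; rewrite !mulf_eq0 (negPf v0) /= orbb => /eqP t1'.
  by move: eR; rewrite t1'; lra.
pose a t : C := x * b (clampR t).
have ca : continuous a by rewrite /a; complex_continuous.
have cy : continuous (fun _ : R => y : C) by exact: cst_continuous.
exists (fun t => to_locus (a t, y)).
  apply: (to_locus_continuous ca cy) => // t.
  have -> : 1 + 2 * a t ^+ 2 * y = 1 + m * b (clampR t) ^+ 2 by rewrite /a /m;
    ring.
  by apply: bm; exact: clampR01.
split.
  rewrite /a clampR_le0 // /b subr0 mul0r mulr0 mulr1 -[RHS]to_locusK.
  by rewrite [val p]surjective_pairing.
by rewrite /a clampR_ge1 // /b subrr mulr0 mulr0 mulr0.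
Qed.

Lemma path_to_base (p : X) : p = to_locus (0, yco p) ->
  exists2 g : R -> X, continuous g & g 0 = p /\ g 1 = x0.
Proof.
move=> pE; have [y0 _] := locusP p.
have [y cy [y_0 y_1 yn0]] := segment_neq0 y0.
have cyc : continuous (fun t => y (clampR t)).
  exact: (continuous_compT cy (@clampR_continuous R)).
have c0 : continuous (fun _ : R => 0 : C) by exact: cst_continuous.
exists (fun t => to_locus (0, y (clampR t))).
  apply: (to_locus_continuous c0 cyc) => // t.
  by rewrite expr0n /= mulr0 mul0r addr0 oner_eq0.
split; first by rewrite clampR_le0 // y_0 -pE.
by rewrite clampR_ge1 // y_1 -[RHS]to_locusK.
Qed.

End Conclusion.

Unset Implicit Arguments.

Theorem theorem3p1 (R : realType) (x0 : kepler_regular_locus R) :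
  exists phi : {multiplicative pi1 R x0 -> semidirect (zpow swap)},
    bijective phi.
Proof.
have [g cg [g0 g1]] := path_to_axis x0.
have [g' cg' [g'0 g'1]] : exists2 g' : R -> kepler_regular_locus R,
  continuous g' &
    g' 0 = to_locus (0, yco x0) /\ g' 1 = locus_base.
  apply: path_to_base; congr (to_locus (0, _)).
  by rewrite /yco to_locusE //= ?(locusP x0).1 // expr0n mulr0 mul0r addr0
    oner_eq0.
have [Phi PhiM Phib] := pi1_change_of_base cg g0 g1.
have [Phi' PhiM' Phib'] := pi1_change_of_base cg' g'0 g'1.
have [Psi PsiM Psib] := @pi1_base_iso R.
pose phi := Psi \o (Phi' \o Phi).
have phiM : {morph phi : u v / (u * v)%g}.
  by move=> u v; rewrite /phi /= PhiM PhiM' PsiM.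
pose phiX : {multiplicative pi1 R x0 -> semidirect (zpow swap)} :=
  HB.pack phi (isMultiplicative.Build _ _ phi phiM).
exists phiX.
by apply: bij_comp => //; exact: bij_comp.
Qed.
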